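(* Let $0<\epsilon<1$. For inputs $x\in\mathbb{R}^n$, one can find a $(1+\epsilon)$-approximation to the $1$-median of $x$ using $O(\log(1/\epsilon)/\epsilon^2)$ linear measurements of $x$ and $\exp(\mathrm{poly}(1/\epsilon))$ time. That is, there is a random linear map $x\mapsto Mx\in\mathbb{R}^{m}$ with $m=O(\log(1/\epsilon)/\epsilon^2)$ and an algorithm that, given $Mx$, outputs $\widehat j\in\mathbb{R}$ such that, with constant probability, $\mathrm{cost}(x,\widehat j)\le(1+\epsilon)\min_{j}\mathrm{cost}(x,j)$.
   Context: For $x\in\mathbb{R}^n$ (viewed as weights on the points $1,\dots,n$ of the line) and $j\in\mathbb{R}$, $\mathrm{cost}(x,j)=\sum_{i=1}^n|x_i|\,|i-j|$; the $1$-median cost of $x$ is $\min_j\mathrm{cost}(x,j)$. *)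

(* Defs.v *)
From HB Require Import structures.
From mathcomp Require Import all_boot all_order all_algebra.
From mathcomp Require Import all_classical all_reals all_analysis.
Set Implicit Arguments.
Unset Strict Implicit.
Unset Printing Implicit Defensive.
Import Order.TTheory GRing.Theory Num.Theory.
Import numFieldNormedType.Exports.
Local Open Scope classical_set_scope.
Local Open Scope ring_scope.

(* The ordinal i : 'I_n stands for the point i + 1 of the line. *)
Definition cost (R : realType) (n : nat) (x : 'cV[R]_n) (j : R) : R :=
  \sum_(i < n) `|x i 0| * `|i.+1%:R - j|.

(* The infimum is a minimum, see median_cost_attained. *)
Definition median_cost (R : realType) (n : nat) (x : 'cV[R]_n) : R :=
  inf (range (cost x)).

Lemma cost_continuous (R : realType) (n : nat) (x : 'cV[R]_n) :
  continuous (cost x).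
Proof.
apply: continuous_big => [|i _ j]; first exact: add_continuous.
apply: cvgM; first exact: cvg_cst.
by apply: cvg_norm; apply: cvgB; [exact: cvg_cst|exact: cvg_id].
Qed.

Lemma median_cost_attained (R : realType) (n : nat) (x : 'cV[R]_n) :
  exists j, cost x j = median_cost x /\ forall k, cost x j <= cost x k.
Proof.
have [|j _ jmin] := @EVT_min R (cost x) 0 n%:R (ler0n _ _).
  by apply: continuous_subspaceT => k; exact: cost_continuous.
have min_all k : cost x j <= cost x k.
  have [k0|k0] := ltP k 0.
    apply: le_trans (jmin 0 _) _; first by rewrite in_itv /= lexx ler0n.
    apply: ler_sum => i _; rewrite ler_wpM2l// subr0.
    have i0 : 0 <= i.+1%:R :> R by rewrite ler0n.
    by rewrite !ger0_norm// ?lerDl ?oppr_ge0 ?addr_ge0 ?oppr_ge0// ltW.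
  have [kn|kn] := leP k n%:R; first by apply: jmin; rewrite in_itv /= k0.
  apply: le_trans (jmin n%:R _) _; first by rewrite in_itv /= lexx ler0n.
  apply: ler_sum => i _; rewrite ler_wpM2l//.
  have iN : i.+1%:R <= n%:R :> R by rewrite ler_nat.
  rewrite !ler0_norm ?subr_le0//; last exact: le_trans iN (ltW kn).
  by rewrite !opprB lerD2r ltW.
exists j; split=> //; apply/eqP; rewrite eq_le; apply/andP; split.
  by apply: lb_le_inf; [exists (cost x j), j|move=> _ [k _ <-]].
by apply: ge_inf; [exists (cost x j) => _ [k _ <-]|exists j].
Qed.

(* Real RAM programs in structured form. Registers have fixed addresses; the
   real memory is addressed indirectly, through an integer register. There are
   no real literals and no rounding from reals to integers. *)
Inductive instr : Type :=
| IConst of nat & nat         (* ireg a := k *)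
| IAdd of nat & nat & nat     (* ireg a := ireg b + ireg c *)
| ISub of nat & nat & nat     (* ireg a := ireg b - ireg c, truncated at 0 *)
| ROfInt of nat & nat         (* rreg a := ireg b *)
| RAdd of nat & nat & nat     (* rreg a := rreg b + rreg c *)
| RSub of nat & nat & nat     (* rreg a := rreg b - rreg c *)
| RMul of nat & nat & nat     (* rreg a := rreg b * rreg c *)
| RDiv of nat & nat & nat     (* rreg a := rreg b / rreg c, with r / 0 = 0 *)
| RLoad of nat & nat          (* rreg a := rmem (ireg b) *)
| RStore of nat & nat.        (* rmem (ireg a) := rreg b *)

Inductive test : Type :=
| ILe of nat & nat            (* ireg a <= ireg b *)
| RLe of nat & nat.           (* rreg a <= rreg b *)

Inductive program : Type :=
| Do of instr
| Seq of program & program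
| If of test & program & program
| While of test & program.

Record state (R : realType) : Type := State {
  ireg : nat -> nat;
  rreg : nat -> R;
  rmem : nat -> R }.

Definition update (V : Type) (f : nat -> V) (a : nat) (v : V) : nat -> V :=
  fun b => if b == a then v else f b.

Definition set_ireg (R : realType) (s : state R) (a k : nat) : state R :=
  State (update (ireg s) a k) (rreg s) (rmem s).

Definition set_rreg (R : realType) (s : state R) (a : nat) (r : R) : state R :=
  State (ireg s) (update (rreg s) a r) (rmem s).

Definition set_rmem (R : realType) (s : state R) (a : nat) (r : R) : state R :=
  State (ireg s) (rreg s) (update (rmem s) a r).

Definition step (R : realType) (c : instr) (s : state R) : state R :=
  match c with
  | IConst a k => set_ireg s a k
  | IAdd a b c => set_ireg s a (ireg s b + ireg s c)%N
  | ISub a b c => set_ireg s a (ireg s b - ireg s c)%N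
  | ROfInt a b => set_rreg s a (ireg s b)%:R
  | RAdd a b c => set_rreg s a (rreg s b + rreg s c)
  | RSub a b c => set_rreg s a (rreg s b - rreg s c)
  | RMul a b c => set_rreg s a (rreg s b * rreg s c)
  | RDiv a b c => set_rreg s a (rreg s b / rreg s c)
  | RLoad a b => set_rreg s a (rmem s (ireg s b))
  | RStore a b => set_rmem s (ireg s a) (rreg s b)
  end.

Definition holds (R : realType) (b : test) (s : state R) : bool :=
  match b with
  | ILe a b => (ireg s a <= ireg s b)%N
  | RLe a b => rreg s a <= rreg s b
  end.

(* exec p s t s': started in s, the program p halts in s' after t steps, where
   each instruction and each evaluation of a test is one step. *)
Inductive exec (R : realType) : program -> state R -> nat -> state R -> Prop :=
| exec_do c s : exec (Do c) s 1 (step c s)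
| exec_seq p q s1 s2 s3 t u :
    exec p s1 t s2 -> exec q s2 u s3 -> exec (Seq p q) s1 (t + u) s3
| exec_if_true b p q s s' t :
    holds b s -> exec p s t s' -> exec (If b p q) s t.+1 s'
| exec_if_false b p q s s' t :
    ~~ holds b s -> exec q s t s' -> exec (If b p q) s t.+1 s'
| exec_while_false b p s : ~~ holds b s -> exec (While b p) s 1 s
| exec_while_true b p s1 s2 s3 t u :
    holds b s1 -> exec p s1 t s2 -> exec (While b p) s2 u s3 ->
    exec (While b p) s1 (t + u).+1 s3.

(* Input: the number m of measurements in ireg 0, n in ireg 1, eps in rreg 0
   and the measurement vector y in rmem 0, ..., rmem (m - 1). All the rest is
   zero. *)
Definition input (R : realType) (n : nat) (eps : R) (m : nat) (y : 'cV[R]_m) :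
    state R :=
  State (fun a => if a == 0%N then m else if a == 1%N then n else 0%N)
        (fun a => if a == 0%N then eps else 0)
        (fun a => if insub a is Some i then y i 0 else 0).

(* The output is read in rreg 0. *)
Definition outputs_in_time (R : realType) (p : program) (s : state R)
    (t : R) (r : R) : Prop :=
  exists (u : nat) (s' : state R), [/\ exec p s u s', u%:R <= t & rreg s' 0%N = r].

(* "E has probability at least p". The library's measures are only meaningful
   on measurable sets; on these this says p <= P E. *)
Definition prob_at_least (R : realType) (d : measure_display)
    (T : measurableType d) (P : probability T R) (p : R) (E : set T) : Prop :=
  exists A : set T, [/\ measurable A, A `<=` E & (p%:E <= P A)%E].

(* Main.v *)
Require Import Defs.
From HB Require Import structures.
From mathcomp Require Import all_boot all_order all_algebra.
From mathcomp Require Import all_classical all_reals all_analysis.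
From mathcomp Require Import complex ring lra zify.
Set Implicit Arguments.
Unset Strict Implicit.
Unset Printing Implicit Defensive.
Import Order.TTheory GRing.Theory Num.Theory.
Import numFieldNormedType.Exports.
Local Open Scope classical_set_scope.
Local Open Scope ring_scope.

(* Writing cost x j = |Dx - jx|_1 with D = diag(1, ..., n), a matrix of Cauchy
   variables applied to Dx and to x gives pairs (a_k, b_k) for which a_k - j b_k
   is a Cauchy variable of scale cost x j. As |Cauchy| has median 1, minimizing
   over j the median of the |a_k - j b_k| approximately minimizes the cost: by a
   Chernoff bound and a union bound over a net of poly(1/eps) points around the
   optimum, O(log(1/eps)/eps^2) pairs suffice. The minimum is attained at a
   crossing j = (a_k +- a_l) / (b_k +- b_l), so it is found by enumeration.

   The Cauchy law is replaced by the uniform law on the 2^k numbers cot(theta)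
   with theta equally spaced modulo pi, so that the probability space is finite.
   Approximate 1-stability follows from the product of the x - i v y over these
   numbers v, which is ((x + y)^(2^k) + (x - y)^(2^k)) / 2: taking arguments, it
   evaluates the sum of the atan ((z - a v) / c) up to an error pi / 2. *)

(** * Discretized Cauchy variables *)

(** The arctangent is the right test function because it is, up to an affine map, the Cauchy
    distribution function: averaging [atan ((z - y) / c)] over a Cauchy variable y of scale a gives
    [atan (z / (c + a))], so scales add. For the 2^k nodes the total error pi / 2 does not grow with
    k; a coordinate thus costs O(2^-k) on average and a row O(n / 2^k). The exponent k may depend on
    n, since it affects neither the number of measurements nor the program. The median of the
    residuals is not convex in j, so a remote j might have a small median. Rows whose |b_k| is
    bounded below exclude all remote j at once. Near the optimum a net suffices because residuals
    are affine in j with slope -b_k. Cauchy slopes are heavy-tailed, so they are cut at |b_k| =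
    O(|x|_1 / eps). The cut costs probability O(eps), which the margin of order eps around 1/2,
    gained by moving the threshold by a factor 1 +- eps, can absorb. This makes the size of the net
    independent of n. *)

(* v +- sqrt (v^2 + 1) = cot (t / 2) and cot ((t + pi) / 2) for v = cot t. *)
Fixpoint cauchy_nodes (R : rcfType) (k : nat) : seq R :=
  if k is k'.+1 then
    flatten [seq [:: v + Num.sqrt (v ^+ 2 + 1); v - Num.sqrt (v ^+ 2 + 1)]
            | v <- cauchy_nodes R k']
  else [:: 0].

Lemma size_cauchy_nodes (R : rcfType) k : size (cauchy_nodes R k) = (2 ^ k)%N.
Proof.
elim: k => //= k IHk; rewrite size_flatten /shape -map_comp.
rewrite (eq_map (_ : _ =1 fun=> 2%N)) // sumnE big_map big_const_seq.
by rewrite count_predT IHk iter_addn_0 expnS.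
Qed.

Local Open Scope complex_scope.

(** The two children of v sum to 2v and have product -1, so their factors multiply to the factor of
    v at (x^2 + y^2, 2xy). This substitution squares both x + y and x - y. *)
Lemma prod_cauchy_nodes (R : rcfType) k (x y : R[i]) :
  \prod_(v <- cauchy_nodes R k) (x - 'i * v%:C * y) =
  ((x + y) ^+ (2 ^ k) + (x - y) ^+ (2 ^ k)) / 2.
Proof.
elim: k x y => [|k IHk] x y /=.
  by rewrite big_cons big_nil !expr1; field.
rewrite big_flatten big_map /=.
under eq_bigr => v _.
  rewrite !big_cons big_nil mulr1.
  have -> : (x - 'i * (v + Num.sqrt (v ^+ 2 + 1))%:C * y) *
      (x - 'i * (v - Num.sqrt (v ^+ 2 + 1))%:C * y) =
      (x ^+ 2 + y ^+ 2) - 'i * v%:C * (2 * x * y).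
    have s2 : (Num.sqrt (v ^+ 2 + 1))%:C ^+ 2 = v%:C ^+ 2 + 1 :> R[i].
      by rewrite -rmorphXn /= sqr_sqrtr ?addr_ge0 ?sqr_ge0 ?ler01 // rmorphD rmorphXn rmorph1.
    have i2 : 'i ^+ 2 = -1 :> R[i] by rewrite sqr_i.
    rewrite rmorphB rmorphD /=; move: (Num.sqrt _)%:C s2 => s s2.
    transitivity (x ^+ 2 - 2 * 'i * v%:C * x * y + 'i ^+ 2 * (v%:C ^+ 2 - s ^+ 2) * y ^+ 2).
      by ring.
    by rewrite i2 s2; ring.
  over.
rewrite IHk expnS !exprM.
have -> : x ^+ 2 + y ^+ 2 + 2 * x * y = (x + y) ^+ 2 by ring.
by have -> : x ^+ 2 + y ^+ 2 - 2 * x * y = (x - y) ^+ 2 by ring.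
Qed.

Definition cis (R : realType) (t : R) : R[i] := cos t +i* sin t.

Lemma cisD (R : realType) (s t : R) : cis (s + t) = cis s * cis t.
Proof. by rewrite /cis cosD sinD; simpc; rewrite [sin s * _ + _]addrC. Qed.

Lemma cis0 (R : realType) : cis 0 = 1 :> R[i].
Proof. by rewrite /cis cos0 sin0. Qed.

Lemma complex_polar (R : realType) (c y : R) : 0 < c ->
  exists2 r : R, 0 < r & c +i* y = r%:C * cis (atan (y / c)).
Proof.
move=> c0; set x := y / c.
have k0 : 0 < cos (atan x).
  by rewrite cos_gt0_pihalf // atan_gtNpi2 atan_ltpi2.
exists (c / cos (atan x)); first by rewrite divr_gt0.
have sE : sin (atan x) = x * cos (atan x).
  by rewrite -{2}(atanK x) /tan divfK // gt_eqF.
have kn0 : cos (atan x) != 0 by rewrite gt_eqF.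
apply/eqP; rewrite /cis sE eq_complex /= !mul0r subr0 addr0.
apply/andP; split; apply/eqP; first by field.
by rewrite /x; field; rewrite kn0 gt_eqF.
Qed.

(** The sum of arctangents is one argument of the product, determined only modulo 2 pi; continuity
    settles the branch later. *)
Lemma cis_prod_polar (R : realType) (c : R) (s : seq R) : 0 < c ->
  exists2 r : R, 0 < r &
  \prod_(y <- s) (c +i* y) = r%:C * cis (\sum_(y <- s) atan (y / c)).
Proof.
move=> c0; elim: s => [|y s [r r0 IH]].
  by exists 1 => //; rewrite !big_nil cis0 mulr1.
have [q q0 E] := complex_polar y c0.
exists (q * r); first exact: mulr_gt0.
by rewrite !big_cons IH E cisD rmorphM /=; ring.
Qed.

Lemma cisN (R : realType) (t : R) : cis t * cis (- t) = 1.
Proof. by rewrite -cisD subrr cis0. Qed.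

Lemma cis_exp (R : realType) (t : R) n : cis t ^+ n = cis (n%:R * t).
Proof.
elim: n => [|n IH]; first by rewrite mul0r cis0.
by rewrite exprS IH -cisD mulrSr mulrDl mul1r addrC.
Qed.

Lemma Re_1D_gt0 (R : rcfType) (w : R[i]) : `|w| < 1 -> 0 < complex.Re (1 + w).
Proof.
move=> w1; have {w1} : `|w| < 1%:C by rewrite rmorph1.
case: w => p q; rewrite normc_def ltcR /= => h; have : `|p| < 1.
  apply: le_lt_trans h; rewrite -sqrtr_sqr ler_wsqrtr // lerDl sqr_ge0 //.
rewrite ltr_norml => /andP[? _].
by change (0 < 1 + p); lra.
Qed.

Section atan_mean.
Variables (R : realType) (k : nat) (z c : R).
Hypothesis c0 : 0 < c.

Let phase (a : R) := \sum_(v <- cauchy_nodes R k) atan ((z - a * v) / c)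
  - (2 ^ k)%:R * atan (z / (c + `|a|)).

Lemma prod_cauchy_nodesE (a : R) :
  \prod_(y <- [seq z - a * v | v <- cauchy_nodes R k]) (c +i* y) =
  (((c + a) +i* z) ^+ (2 ^ k) + ((c - a) +i* z) ^+ (2 ^ k)) / 2.
Proof.
have := prod_cauchy_nodes k (c +i* z) a%:C.
rewrite (_ : c +i* z + a%:C = (c + a) +i* z); last by simpc.
rewrite (_ : c +i* z - a%:C = (c - a) +i* z); last by simpc.
move=> <-; rewrite big_map; apply: eq_bigr => v _; simpc.
by rewrite mulrC.
Qed.

(** With B = c + |a| + iz and A = c - |a| + iz, the product over the nodes is (B^N + A^N) / 2 for N
    = 2^k. Dividing by B^N, whose argument is the subtracted term, leaves a positive multiple of 1 +
    (A / B)^N, and |A| < |B| when a is nonzero. *)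
Lemma cos_phase_gt0 (a : R) : 0 < cos (phase a).
Proof.
have [->|a0] := eqVneq a 0.
  rewrite /phase normr0 addr0; under eq_bigr do rewrite mul0r subr0.
  rewrite big_const_seq count_predT size_cauchy_nodes iter_addr_0.
  by rewrite mulr_natl subrr cos0.
have [r r0] := cis_prod_polar [seq z - a * v | v <- cauchy_nodes R k] c0.
rewrite prod_cauchy_nodesE.
have ca0 : 0 < c + `|a| by rewrite ltr_wpDr.
have [q q0 qE] := complex_polar z ca0.
set B := (c + `|a|) +i* z in qE.
set A := (c - `|a|) +i* z.
have -> : ((c + a) +i* z) ^+ (2 ^ k) + ((c - a) +i* z) ^+ (2 ^ k) =
    B ^+ (2 ^ k) + A ^+ (2 ^ k).
  rewrite /A /B; case: (ger0P a) => _; first by [].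
  by rewrite opprK [RHS]addrC.
have B0 : B != 0 by rewrite eq_complex /= negb_and gt_eqF.
have AB : `|(A / B) ^+ (2 ^ k)| < 1.
  rewrite normrX exprn_ilt1 ?normr_ge0 ?expn_eq0 //.
  rewrite normf_div ltr_pdivrMr ?normr_gt0 // mul1r /A /B !normc_def /= ltcR.
  have a1 : 0 < `|a| by rewrite normr_gt0.
  rewrite ltr_sqrt; last by rewrite ltr_pwDl ?exprn_gt0 ?sqr_ge0.
  rewrite ltrD2r -subr_gt0.
  rewrite (_ : _ - _ = 4 * (c * `|a|)); last by move: `|a| => b; ring.
  by rewrite mulr_gt0 // mulr_gt0.
have {AB} := Re_1D_gt0 AB.
have -> : B ^+ (2 ^ k) + A ^+ (2 ^ k) = B ^+ (2 ^ k) * (1 + (A / B) ^+ (2 ^ k)).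
  by rewrite expr_div_n mulrDr mulr1 mulrCA divff ?mulr1 // expf_neq0.
set w := 1 + _; rewrite big_map qE exprMn cis_exp => w0 E.
have {}E : r%:C * cis (phase a) = (q ^+ (2 ^ k) / 2)%:C * w.
  rewrite /phase cisD mulrA -E; set t := _%:R * _.
  transitivity ((q%:C ^+ (2 ^ k) / 2) * w * (cis t * cis (- t))); first by ring.
  by rewrite cisN mulr1 rmorphM /= rmorphXn /= fmorphV rmorph_nat.
have {E} : r * cos (phase a) = q ^+ (2 ^ k) / 2 * complex.Re w.
  by case: w {w0} E => p s; rewrite /cis; simpc => -[].
move=> E; rewrite -(pmulr_rgt0 _ r0) E mulr_gt0 // divr_gt0 // exprn_gt0 //.
Qed.

(* [phase] is continuous in [a], vanishes at 0 and never meets +-pi/2, where its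
   cosine would vanish. *)
Lemma atan_mean (a : R) :
  `|\sum_(v <- cauchy_nodes R k) atan ((z - a * v) / c)
    - (2 ^ k)%:R * atan (z / (c + `|a|))| <= pi / 2.
Proof.
rewrite -/(phase a) leNgt; apply/negP => h.
have csum : continuous (fun t : R =>
    \sum_(v <- cauchy_nodes R k) atan ((z - t * a * v) / c)).
  apply: continuous_big => [|v _ t]; first exact: add_continuous.
  apply: continuous_comp; last exact: continuous_atan.
  apply: cvgM; last exact: cvg_cst.
  apply: cvgB; first exact: cvg_cst.
  by apply: cvgM; [apply: cvgM; [exact: cvg_id|exact: cvg_cst]|exact: cvg_cst].
have cont : {within `[0, 1], continuous (fun t => phase (t * a))}.
  apply: continuous_subspaceT => t; rewrite /phase; apply: cvgB.
    exact: csum.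
  apply: cvgM; first exact: cvg_cst.
  apply: continuous_comp; last exact: continuous_atan.
  apply: cvgM; first exact: cvg_cst.
  apply: cvgV; first by rewrite gt_eqF // ltr_wpDr.
  apply: cvgD; first exact: cvg_cst.
  by apply: cvg_norm; apply: cvgM; [exact: cvg_id|exact: cvg_cst].
have phase0 : phase 0 = 0.
  rewrite /phase normr0 addr0; under eq_bigr do rewrite mul0r subr0.
  rewrite big_const_seq count_predT size_cauchy_nodes iter_addr_0.
  by rewrite mulr_natl subrr.
have pi20 : 0 < pi / 2 :> R by rewrite divr_gt0 ?pi_gt0.
have no_cross (v : R) : cos v = 0 ->
    ~ (Num.min (phase (0 * a)) (phase (1 * a)) <= v
       <= Num.max (phase (0 * a)) (phase (1 * a))).
  move=> cv /(IVT ler01 cont)[t _ E].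
  by have := cos_phase_gt0 (t * a); rewrite E cv ltxx.
move: h; rewrite ltr_normr => /orP[h|h].
  apply: (no_cross (pi / 2)); first exact: cos_pihalf.
  rewrite mul0r mul1r phase0 ge_min le_max (ltW h) (ltW pi20) orbT //.
apply: (no_cross (- (pi / 2))); first by rewrite cosN cos_pihalf.
have {}h : phase a <= - (pi / 2) by rewrite lerNr ltW.
by rewrite mul0r mul1r phase0 ge_min le_max h oppr_le0 (ltW pi20) orbT.
Qed.
End atan_mean.

Local Close Scope complex_scope.

(** * Elementary estimates for the arctangent *)

Lemma atan_MVT (R : realType) (x y : R) : x <= y ->
  exists2 c, x <= c <= y & atan y - atan x = (1 + c ^+ 2)^-1 * (y - x).
Proof.
move=> xy; have at' (t : R) : t \in `]x, y[ -> is_derive t 1 (@atan R) (1 + t ^+ 2)^-1.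
  by move=> _; exact: is_derive1_atan.
have [|c] := MVT_segment xy at'.
  by apply: continuous_subspaceT => t; exact: continuous_atan.
by rewrite in_itv /= => ? ?; exists c.
Qed.

Lemma ler_atanB (R : realType) (x y : R) : x <= y -> atan y - atan x <= y - x.
Proof.
move=> xy; have [c _ ->] := atan_MVT xy.
rewrite ler_piMl ?subr_ge0 // invf_le1 ?lerDl ?sqr_ge0 //.
by rewrite ltr_pwDl // sqr_ge0.
Qed.

Lemma ger_atanB (R : realType) (x y : R) : 0 <= x -> x <= y ->
  (y - x) / (1 + y ^+ 2) <= atan y - atan x.
Proof.
move=> x0 xy; have [c /andP[xc cy] ->] := atan_MVT xy.
have p (t : R) : 0 < 1 + t ^+ 2 by rewrite ltr_pwDl // sqr_ge0.
rewrite mulrC ler_wpM2r ?subr_ge0 // lef_pV2 ?posrE // lerD2l.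
by rewrite lerXn2r // nnegrE ?(le_trans x0) // (le_trans xc).
Qed.

Lemma atan_gt0 (R : realType) (x : R) : 0 < x -> 0 < atan x.
Proof. by move=> x0; rewrite -atan0 lt_atan. Qed.

Lemma atanV (R : realType) (x : R) : 0 < x -> atan x^-1 = pi / 2 - atan x.
Proof.
move=> x0; have a0 := atan_gt0 x0; have a1 := atan_ltpi2 x.
have E : tan (pi / 2 - atan x) = x^-1.
  rewrite /tan -[pi / 2 - _]opprB sinN cosN sinBpihalf cosBpihalf opprK.
  by rewrite -[in RHS](atanK x) /tan invf_div.
rewrite -E tanK // in_itv /=; apply/andP; split; last by rewrite gtrBl.
by rewrite ltrBrDl; have := pi_gt0 R; lra.
Qed.

(** The restriction r <= 1 allows quadratic terms in r to be absorbed in linear ones. *)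
Lemma ler_addr_small (R : realType) (x y K : R) : 0 <= K ->
  (forall r, 0 < r -> r <= 1 -> x <= y + r * K) -> x <= y.
Proof.
move=> K0 H; apply/ler_addgt0Pr => e e0.
have K1 : 0 < K + 1 by rewrite ltr_wpDl.
apply: le_trans (H (Num.min 1 (e / (K + 1))) _ _) _.
- by rewrite lt_min ltr01 divr_gt0.
- by rewrite ge_min lexx.
rewrite lerD2l; apply: (@le_trans _ _ (e / (K + 1) * K)).
  by rewrite ler_wpM2r // ge_min lexx orbT.
rewrite mulrAC ler_pdivrMr // ler_pM2l // lerDl ler01 //.
Qed.

(** * Concentration of the rows *)

Section majority.
Variables (R : realType) (X : finType) (A : pred X) (m : nat) (d : R).
Hypotheses (X0 : (0 < #|X|)%N) (d0 : 0 <= d).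
Hypothesis rareA : \sum_x (A x)%:R <= (2^-1 - d) * #|X|%:R :> R.

(* Markov's inequality for the product of the independent factors (1 + d)^(+-1). *)
Lemma majority_rare :
  \sum_(w : {ffun 'I_m -> X}) (m <= 2 * #|[pred k | A (w k)]|)%N%:R <=
  (1 - d ^+ 2) ^+ m * #|{ffun 'I_m -> X}|%:R :> R.
Proof.
set b := 1 + d; have b0 : 0 < b by rewrite /b ltr_wpDr.
pose G x := if A x then b else b^-1.
have b1 : 1 <= b by rewrite /b lerDl.
have step1 (w : {ffun 'I_m -> X}) :
    (m <= 2 * #|[pred k | A (w k)]|)%N%:R <= \prod_k G (w k).
  rewrite (bigID [pred k | A (w k)]) /=.
  rewrite (eq_bigr (fun=> b)); last by move=> k; rewrite /G => ->.
  rewrite [X in _ * X](eq_bigr (fun=> b^-1)); last first.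
    by move=> k; rewrite /G => /negbTE ->.
  rewrite !prodr_const.
  set p := #|_|; set q := #|_|.
  have pq : (p + q = m)%N.
    by rewrite /p /q -[RHS]card_ord -(cardC [pred k | A (w k)]).
  case: leqP => [h|_]; last by rewrite mulr_ge0 // exprn_ge0 ?invr_ge0 // ltW.
  have qp : (q <= p)%N by rewrite -(leq_add2l p) pq addnn -mul2n.
  rewrite -(subnK qp) exprD -mulrA -exprMn divff ?gt_eqF // expr1n mulr1.
  by rewrite exprn_ege1.
apply: (le_trans (ler_sum _ (fun w _ => step1 w))).
have -> : \sum_(w : {ffun 'I_m -> X}) \prod_k G (w k) = (\sum_x G x) ^+ m.
  rewrite -(bigA_distr_bigA (fun (_ : 'I_m) x => G x)) prodr_const card_ord //.
rewrite card_ffun card_ord natrX -exprMn lerXn2r ?nnegrE //.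
- by rewrite sumr_ge0 // => x _; rewrite /G; case: ifP => _; rewrite ?invr_ge0 ltW.
- rewrite mulr_ge0 // subr_ge0 expr_le1 //.
  (* [rareA] bounds a nonnegative sum, which forces d <= 1/2. *)
  have : 0 <= (2^-1 - d) * #|X|%:R by apply: le_trans rareA; rewrite sumr_ge0.
  by rewrite pmulr_lge0 ?ltr0n //; lra.
have -> : \sum_x G x = b^-1 * #|X|%:R + (b - b^-1) * \sum_x (A x)%:R.
  rewrite mulr_sumr mulr_natr -sumr_const -big_split /=; apply: eq_bigr => x _.
  by rewrite /G; case: (A x); rewrite ?mulr1 ?mulr0 ?addr0 // addrC subrK.
have bb : 0 <= b - b^-1.
  by rewrite subr_ge0 (le_trans _ b1) // invf_le1.
apply: le_trans (lerD (lexx _) (ler_wpM2l bb rareA)) _.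
rewrite mulrA -mulrDl ler_wpM2r // -(ler_pM2l b0).
(* The right-hand side is 1 + d - 3/2 d^2 - d^3, at most (1 + d) (1 - d^2). *)
have -> : b * (b^-1 + (b - b^-1) * (2^-1 - d)) = 1 + (b ^+ 2 - 1) * (2^-1 - d).
  by field; rewrite gt_eqF.
rewrite /b; nra.
Qed.
End majority.

(** * Replacing Cauchy variables by nodes, one coordinate at a time *)

Section resample.
Variables (R : realType) (n : nat) (T : finType).

Definition resample (f : {ffun 'I_n -> T}) (i : 'I_n) (t : T) :=
  [ffun j => if j == i then t else f j].

(** Exchanging [f i] with [t] is an involution on the pairs (f, t), so resampling one coordinate
    preserves the uniform law. *)
Lemma sum_resample (i : 'I_n) (F : {ffun 'I_n -> T} -> R) :
  \sum_f \sum_t F (resample f i t) = #|T|%:R * \sum_f F f.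
Proof.
rewrite pair_big /=.
pose h (p : {ffun 'I_n -> T} * T) := (resample p.1 i p.2, p.1 i).
have hK : cancel h h.
  move=> [f t]; rewrite /h /= ffunE eqxx; congr (_, _).
  by apply/ffunP => j; rewrite !ffunE; case: eqP => // ->.
rewrite (reindex h) /=; last by exists h => p _; exact: hK.
rewrite (eq_bigr (fun p => F p.1)); last first.
  move=> [f t] _ /=; congr F.
  by apply/ffunP => j; rewrite !ffunE; case: eqP => // ->.
rewrite -(pair_big xpredT xpredT (fun f _ => F f)) /= mulr_sumr.
by apply: eq_bigr => f _; rewrite sumr_const mulr_natl.
Qed.

End resample.

Section sketch_row.
Variables (R : realType) (n k : nat).

Let N := (2 ^ k)%N.
Local Notation Row := {ffun 'I_n -> 'I_(2 ^ k)}.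

Definition cauchy_node (t : 'I_(2 ^ k)) : R := nth 0 (cauchy_nodes R k) t.

Definition dot (u : 'I_n -> R) (f : {ffun 'I_n -> 'I_(2 ^ k)}) : R :=
  \sum_i u i * cauchy_node (f i).

Lemma sum_cauchy_node (F : R -> R) :
  \sum_(v <- cauchy_nodes R k) F v = \sum_t F (cauchy_node t).
Proof. by rewrite (big_nth 0) size_cauchy_nodes big_mkord. Qed.

Let atan_mean_node (z c a : R) : 0 < c ->
  `|\sum_t atan ((z - a * cauchy_node t) / c) - N%:R * atan (z / (c + `|a|))|
  <= pi / 2.
Proof.
by move=> c0; have := atan_mean k z c0 a;
  rewrite (sum_cauchy_node (fun v => atan ((z - a * v) / c))).
Qed.

(* Hybrid argument: [hyb j] has its first [j] coordinates discretized and the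
   others replaced by Cauchy variables. *)
Lemma mean_atan_dot (u : 'I_n -> R) (z c : R) : 0 < c ->
  `|\sum_f atan ((z - dot u f) / c)
    - #|{ffun 'I_n -> 'I_(2 ^ k)}|%:R * atan (z / (c + \sum_i `|u i|))|
  <= #|{ffun 'I_n -> 'I_(2 ^ k)}|%:R * (n%:R / N%:R * (pi / 2)).
Proof.
move=> c0.
pose hyb (j : nat) (f : Row) :=
  atan ((z - \sum_(i < n | (i < j)%N) u i * cauchy_node (f i))
        / (c + \sum_(i < n | (j <= i)%N) `|u i|)).
have N0 : 0 < N%:R :> R by rewrite ltr0n expn_gt0.
have hyb0 : \sum_f hyb 0 f = #|{: Row}|%:R * atan (z / (c + \sum_i `|u i|)).
  rewrite (eq_bigr (fun=> atan (z / (c + \sum_i `|u i|)))).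
    by rewrite sumr_const mulr_natl.
  by move=> f _; rewrite /hyb big_pred0 // subr0.
have hybn : \sum_f hyb n f = \sum_f atan ((z - dot u f) / c).
  apply: eq_bigr => f _; rewrite /hyb [X in c + X]big_pred0 ?addr0; last first.
    by move=> i; rewrite leqNgt ltn_ord.
  by congr (atan ((_ - _) / _)); apply: eq_bigl => i; rewrite ltn_ord.
rewrite -hyb0 -hybn.
suff H j : (j <= n)%N -> `|\sum_f hyb j f - \sum_f hyb 0 f| <=
    #|{: Row}|%:R * (j%:R / N%:R * (pi / 2)) by exact: H.
elim: j => [_|j IH jn]; first by rewrite subrr normr0 mul0r mul0r mulr0.
have {IH} := IH (ltnW jn).
suff : `|\sum_f hyb j.+1 f - \sum_f hyb j f| <= #|{: Row}|%:R * (N%:R^-1 * (pi / 2)).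
  move=> h1 h2; rewrite -(subrKA (\sum_f hyb j f)); apply: le_trans (ler_normD _ _) _.
  apply: le_trans (lerD h1 h2) _; rewrite -mulrDr -mulrDl -[X in X + _]mul1r.
  by rewrite -mulrDl -[j.+1%:R]natr1 [1 + _]addrC.
(* Multiplying by N makes room for a fresh value of coordinate j. For the other coordinates fixed,
   the sum over this value is the one of [atan_mean], with the remaining Cauchy scales collected in
   its parameter c. *)
rewrite -(ler_pM2l N0) -{1}[N%:R]ger0_norm ?ler0n // -normrM mulrBr.
pose i := Ordinal jn.
have EN : N%:R = #|'I_(2 ^ k)|%:R :> R by rewrite card_ord.
rewrite {1}EN -(sum_resample i) mulr_sumr -sumrB.
apply: le_trans (ler_norm_sum _ _ _) _.
apply: (@le_trans _ _ (\sum_(f : Row) (pi / 2))); last first.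
  by rewrite big_const iter_addr_0 mulrCA (mulVKf (lt0r_neq0 N0)) mulr_natl.
apply: ler_sum => f _.
set y := z - \sum_(l < n | (l < j)%N) u l * cauchy_node (f l).
set e := c + \sum_(l < n | (j.+1 <= l)%N) `|u l|.
have e0 : 0 < e by rewrite ltr_wpDr // sumr_ge0.
have := atan_mean_node y (u i) e0.
rewrite (_ : e + `|u i| = c + \sum_(l < n | (j <= l)%N) `|u l|); last first.
  rewrite /e -addrA; congr (_ + _); rewrite [RHS](bigD1 i) //= addrC.
  congr (_ + _); apply: eq_bigl => l.
  by rewrite ltn_neqAle andbC -val_eqE /= eq_sym.
rewrite (eq_bigr (fun t => hyb j.+1 (resample f i t))) // => t _.
rewrite /hyb -/e /y -addrA -opprD; congr (atan ((_ - _) / _)).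
rewrite [RHS](bigD1 i) //= ffunE eqxx addrC; congr (_ + _).
apply: congr_big => // [l|l lj]; last by rewrite ffunE -val_eqE /= ltn_eqF.
by rewrite ltnS -val_eqE /= ltn_neqAle andbC.
Qed.

End sketch_row.

(** * Small-ball and tail bounds for one row *)

Section smoothed_interval.
Variable R : realType.

(* [window z c y] smooths the indicator of the interval [-z, z] at scale c. *)
Definition window (z c y : R) : R :=
  (atan ((z - y) / c) - atan ((- z - y) / c)) / pi.

Lemma window_ge0 z c y : 0 <= z -> 0 < c -> 0 <= window z c y.
Proof.
move=> z0 c0; rewrite divr_ge0 ?pi_ge0 // subr_ge0 le_atan //.
by rewrite ler_pM2r ?invr_gt0 // lerD2r ge0_cp.
Qed.

Lemma window_le1 z c y : window z c y <= 1.
Proof.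
rewrite ler_pdivrMr ?pi_gt0 // mul1r.
have := atan_ltpi2 ((z - y) / c); have := atan_gtNpi2 ((- z - y) / c); lra.
Qed.

Lemma ler_pi_self (r : R) : 0 <= r -> r / pi <= r.
Proof.
by move=> r0; rewrite ler_pdivrMr ?pi_gt0 // ler_peMr // (le_trans _ (pi_ge2 R)) // ler1n.
Qed.

(** The defect pi / 2 - atan (1 / r) equals atan r, which is at most r. *)
Lemma atan_far (r x : R) : 0 < r -> r^-1 <= x -> pi / 2 - r <= atan x.
Proof.
move=> r0 rx; apply: le_trans (le_atan rx); rewrite atanV // lerD2l lerN2.
by have := ler_atanB (ltW r0); rewrite atan0 !subr0.
Qed.

Lemma window_near (z' z c r y : R) : 0 < r -> 0 < c -> c <= r * (z - z') ->
  `|y| <= z' -> 1 - r <= window z c y.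
Proof.
move=> r0 c0 cr; rewrite ler_norml => /andP[y1 y2].
have h1 : pi / 2 - r <= atan ((z - y) / c).
  apply: atan_far => //; rewrite ler_pdivlMr // ler_pdivrMl //.
  by apply: le_trans cr _; rewrite ler_pM2l //; lra.
have h2 : pi / 2 - r <= - atan ((- z - y) / c).
  rewrite -atanN -mulNr; apply: atan_far => //; rewrite ler_pdivlMr // ler_pdivrMl //.
  by apply: le_trans cr _; rewrite ler_pM2l //; lra.
rewrite ler_pdivlMr ?pi_gt0 //; have := pi_ge2 R; nra.
Qed.

Lemma window_far (z' z c r y : R) : 0 < r -> 0 < c -> c <= r * (z' - z) ->
  z' < `|y| -> window z c y <= r.
Proof.
move=> r0 c0 cr; rewrite ltr_normr => zy.
suff : atan ((z - y) / c) - atan ((- z - y) / c) <= r.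
  rewrite /window => h; apply: (@le_trans _ _ (r / pi)); last exact/ler_pi_self/ltW.
  by rewrite ler_pM2r // invr_gt0 pi_gt0.
case/orP: zy => zy.
  have : pi / 2 - r <= - atan ((z - y) / c).
    rewrite -atanN -mulNr; apply: atan_far => //; rewrite ler_pdivlMr // ler_pdivrMl //.
    by apply: le_trans cr _; rewrite ler_pM2l //; lra.
  by have := atan_gtNpi2 ((- z - y) / c); lra.
have : pi / 2 - r <= atan ((- z - y) / c).
  apply: atan_far => //; rewrite ler_pdivlMr // ler_pdivrMl //.
  by apply: le_trans cr _; rewrite ler_pM2l //; lra.
by have := atan_ltpi2 ((z - y) / c); lra.
Qed.

End smoothed_interval.

Section sketch_row_tails.
Variables (R : realType) (n k : nat) (u : 'I_n -> R).
Local Notation Row := {ffun 'I_n -> 'I_(2 ^ k)}.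
Local Notation s := (\sum_i `|u i|).
Local Notation err := (n%:R / (2 ^ k)%:R : R).

(** The main term is the probability of [-z, z] for a Cauchy variable of scale c + s: smoothing at
    scale c just adds to the scale of the row. Each of the two arctangents contributes half of the
    error. *)
Lemma mean_window_dot (z c : R) : 0 < c ->
  `|\sum_(f : Row) window z c (dot u f) - #|{: Row}|%:R * (2 / pi * atan (z / (c + s)))|
  <= #|{: Row}|%:R * err.
Proof.
move=> c0; have := mean_atan_dot k u z c0; have := mean_atan_dot k u (- z) c0.
rewrite /window -mulr_suml sumrB mulNr atanN.
set a := \sum_f atan ((- z - _) / c); set b := \sum_f atan _; set w := atan _; set K : R := #|_|%:R.
have p0 := pi_gt0 R.
(* [field] would unfold [pi]. *)
move: (@pi R) p0 => p p0; have pn0 : p != 0 by rewrite gt_eqF.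
have -> : K * (2 / p * w) = (K * w - K * - w) / p by field.
have -> : K * err = (K * (err * (p / 2)) + K * (err * (p / 2))) / p.
  by field; rewrite pn0 pnatr_eq0 -lt0n expn_gt0.
move=> h1 h2; have pv0 : 0 < p^-1 by rewrite invr_gt0.
rewrite -mulrBl normrM [`|p^-1|]gtr0_norm //.
rewrite ler_pM2r // (_ : b - a - _ = (b - K * w) - (a - K * - w)); last by ring.
by apply: le_trans (ler_normB _ _) _; exact: lerD.
Qed.

Lemma dot_small_ball (t : R) : 0 < s -> 0 < t ->
  \sum_(f : Row) (`|dot u f| <= t * s)%R%:R <= (2 / pi * atan t + err) * #|{: Row}|%:R.
Proof.
move=> s0 t0; have p2 := pi_ge2 R; have p0 := pi_gt0 R.
set K : R := #|_|%:R; have K0 : 0 <= K by rewrite ler0n.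
apply: (@ler_addr_small _ _ _ (K * 2)) => [|r r0 r1]; first exact: mulr_ge0.
(* The interval is widened by r s, and c is r times this margin, as [window_near] requires; both
   perturbations vanish with r. *)
set z := (t + r) * s; set c := r * (r * s).
have c0 : 0 < c by rewrite !mulr_gt0.
have z0 : 0 <= z by rewrite mulr_ge0 ?addr_ge0 ?ltW.
have := mean_window_dot z c0; rewrite ler_norml => /andP[_].
rewrite -/K lerBlDr => h.
apply: (@le_trans _ _ (\sum_(f : Row) (window z c (dot u f) + r))).
  apply: ler_sum => f _; case: (leP `|dot u f| (t * s)) => [le|_]; last first.
    by rewrite /= mulr0n addr_ge0 ?window_ge0 // ltW.
  rewrite /= mulr1n -lerBlDr; apply: window_near le => //.
  by rewrite /c /z -mulrBl addrAC subrr add0r.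
rewrite big_split /= sumr_const -(mulr_natl r) -/K.
have : atan (z / (c + s)) <= atan t + r.
  apply: (@le_trans _ _ (atan (t + r))).
    rewrite le_atan // ler_pdivrMr ?addr_gt0 // /z ler_wpM2l ?addr_ge0 ?ltW //.
    by rewrite ltr_pwDl.
  by have := @ler_atanB _ t (t + r); rewrite lerDl (ltW r0) => /(_ isT); lra.
set w := atan _ in h *; set v := atan t => wv.
have {wv} : 2 / pi * w <= 2 / pi * v + r.
  apply: (@le_trans _ _ (2 / pi * (v + r))); first by rewrite ler_pM2l // divr_gt0.
  by rewrite mulrDr lerD2l ler_piMl ?(ltW r0) // ler_pdivrMr // mul1r.
move: (2 / pi * w) (2 / pi * v) h => w' v' h wv.
nra.
Qed.

Lemma dot_tail (t : R) : 0 < t ->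
  \sum_(f : Row) (t * s < `|dot u f|)%R%:R <= (1 - 2 / pi * atan t + err) * #|{: Row}|%:R.
Proof.
move=> t0; have p2 := pi_ge2 R; have p0 := pi_gt0 R.
have s_ge0 : 0 <= s by exact: sumr_ge0.
set K : R := #|_|%:R; have K0 : 0 <= K by rewrite ler0n.
have at1 : 2 / pi * atan t <= 1.
  by rewrite mulrAC ler_pdivrMr // mul1r mulrC -ler_pdivlMr // ltW // atan_ltpi2.
have [s0|s0] := eqVneq s 0.
  rewrite big1 => [|f _]; first by rewrite mulr_ge0 // addr_ge0 ?divr_ge0 ?ler0n // subr_ge0.
  suff -> : dot u f = 0 by rewrite s0 mulr0 normr0 ltxx.
  rewrite /dot big1 // => i _.
  move/eqP: s0; rewrite psumr_eq0 // => /allP /(_ i).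
  by rewrite mem_index_enum normr_eq0 => /(_ isT) /eqP ->; rewrite mul0r.
have {s_ge0} s0 : 0 < s by rewrite lt_def s0.
apply: (@ler_addr_small _ _ _ (K * (2 + t))) => [|r r0 r1].
  by rewrite mulr_ge0 // addr_ge0 // ltW.
(* Here z may be negative, so [window] may be negative too; only its upper bounds are used. *)
set z := (t - r) * s; set c := r * (r * s).
have c0 : 0 < c by rewrite !mulr_gt0.
have := mean_window_dot z c0; rewrite ler_norml => /andP[+ _].
rewrite -/K lerBrDr => h.
apply: (@le_trans _ _ (\sum_(f : Row) (1 - window z c (dot u f) + r))).
  apply: ler_sum => f _; case: (ltP (t * s) `|dot u f|) => [lt|_]; last first.
    by rewrite /= mulr0n addr_ge0 ?subr_ge0 ?window_le1 ?ltW.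
  rewrite /= mulr1n -addrA lerDl addrC subr_ge0; apply: window_far lt => //.
  by rewrite /c /z -mulrBl subKr.
rewrite big_split sumrB /= !sumr_const -(mulr_natl r) -/K.
have : atan t - r * (1 + t) <= atan (z / (c + s)).
  have sc0 : 0 < c + s by rewrite addr_gt0.
  have tr0 : 0 < t * r by rewrite mulr_gt0.
  have r2 : r * r <= r by rewrite ler_piMr // ltW.
  have rr0 : 0 < r * r by rewrite mulr_gt0.
  have zt : z / (c + s) <= t.
    rewrite ler_pdivrMr // -subr_ge0 /z /c.
    rewrite (_ : _ - _ = (t * r * r + r) * s); last by ring.
    by rewrite mulr_ge0 ?addr_ge0 ?mulr_ge0 // ltW.
  have : t - z / (c + s) <= r * (1 + t).
    rewrite lerBlDr -lerBlDl ler_pdivlMr // -subr_ge0 /z /c.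
    rewrite (_ : _ - _ = (r * r * r * (1 + t) + t * (r - r * r)) * s); last by ring.
    apply: mulr_ge0; last exact: ltW.
    by rewrite addr_ge0 // mulr_ge0 ?subr_ge0 ?mulr_ge0 ?addr_ge0 // ltW.
  by have := ler_atanB zt; lra.
set w := atan _ in h *; set v := atan t => wv.
have {wv} : 2 / pi * v - r * (1 + t) <= 2 / pi * w.
  apply: (@le_trans _ _ (2 / pi * (v - r * (1 + t)))); last by rewrite ler_pM2l // divr_gt0.
  have rt0 : 0 <= r * (1 + t) by rewrite mulr_ge0 ?addr_ge0 // ltW.
  by rewrite mulrBr lerD2l lerN2 ler_piMl // ler_pdivrMr // mul1r.
move: (2 / pi * w) (2 / pi * v) h => w' v' h wv.
nra.
Qed.

End sketch_row_tails.

(** * The median program *)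

Section runs.
Variable R : realType.
Implicit Types (s : state R) (Q : state R -> Prop).

(** Total correctness in weakest-precondition style, with a time bound that composes along the
    program. *)
Definition runs (p : program) (T : nat) s Q : Prop :=
  exists u s', [/\ exec p s u s', (u <= T)%N & Q s'].

Lemma runs_weaken p T T' s Q Q' : (T <= T')%N -> (forall s', Q s' -> Q' s') ->
  runs p T s Q -> runs p T' s Q'.
Proof.
move=> TT QQ [u [s' [e uT q]]]; exists u, s'.
by split; [|exact: leq_trans TT|exact: QQ].
Qed.

Lemma runs_le p T T' s Q : (T <= T')%N -> runs p T s Q -> runs p T' s Q.
Proof. by move=> TT; exact: runs_weaken. Qed.

Lemma runs_do c s Q : Q (step c s) -> runs (Do c) 1 s Q.
Proof. by move=> q; exists 1%N, (step c s); split => //; constructor. Qed.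

Lemma runs_seq p q T U s Q :
  runs p T s (fun s' => runs q U s' Q) -> runs (Seq p q) (T + U) s Q.
Proof.
move=> [u [s1 [e1 uT [v [s2 [e2 vU q2]]]]]]; exists (u + v)%N, s2.
by split=> //; [exact: exec_seq e1 e2|exact: leq_add].
Qed.

Lemma runs_do_seq c q U s Q : runs q U (step c s) Q -> runs (Seq (Do c) q) U.+1 s Q.
Proof. by move=> h; rewrite -add1n; apply: runs_seq; exact: runs_do. Qed.

Lemma runs_if b p q T s Q :
  (holds b s -> runs p T s Q) -> (~~ holds b s -> runs q T s Q) ->
  runs (If b p q) T.+1 s Q.
Proof.
move=> hp hq; have [h|h] := boolP (holds b s).
  have [u [s' [e uT q']]] := hp h.
  by exists u.+1, s'; split => //; exact: exec_if_true.
have [u [s' [e uT q']]] := hq h.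
by exists u.+1, s'; split => //; exact: exec_if_false.
Qed.

(* Index register [i] runs through 1, 3, ..., with [ireg 0] holding the bound
   and [ireg 3] the stride 2. *)
Definition for_pairs (i : nat) (p : program) : program :=
  Seq (Do (IConst i 1)) (While (ILe i 0) (Seq p (Do (IAdd i i 3)))).

(** Since 2k + 1 <= 2 m0 exactly when k < m0, the body runs m0 times. A pass adds one test and one
    increment to T; the final 2 counts the initialization and the failing test. The invariant is
    requested in the already incremented state. *)
Lemma runs_for_pairs i p T m0 (I : nat -> state R -> Prop) s :
  I 0%N (set_ireg s i 1) ->
  (forall k s, I k s -> ireg s i = k.*2.+1 /\ ireg s 0 = m0.*2) ->
  (forall k s, (k < m0)%N -> I k s -> runs p T s (fun s' =>
     [/\ ireg s' 3 = 2%N, ireg s' i = k.*2.+1 & I k.+1 (set_ireg s' i k.*2.+3)])) ->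
  runs (for_pairs i p) (m0 * (T + 2) + 2) s (I m0).
Proof.
move=> I0 Ii Ip.
suff H r : forall k s, (k + r = m0)%N -> I k s ->
    runs (While (ILe i 0) (Seq p (Do (IAdd i i 3)))) (r * (T + 2) + 1) s (I m0).
  by rewrite addnS; apply: runs_do_seq; exact: (H m0 0%N).
elim: r => [|r IH] k s1 kr Ik; have [e1 e2] := Ii _ _ Ik.
  exists 1%N, s1; split=> //; last by rewrite -kr addn0.
  by apply: exec_while_false; rewrite /= e1 e2; lia.
have km : (k < m0)%N by lia.
have [u [s2 [x2 uT [e3 e4 I2]]]] := Ip _ _ km Ik.
have [|v [s3 [x3 vT I3]]] := IH k.+1 _ _ I2; first by lia.
exists ((u + 1) + v).+1%N, s3; split=> //; last by nia.
apply: exec_while_true; last exact: x3.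
  by rewrite /= e1 e2; lia.
apply: exec_seq x2 _.
have -> : set_ireg s2 i k.*2.+3 = step (IAdd i i 3) s2 by rewrite /= e3 e4 addn2.
exact: exec_do.
Qed.

End runs.

(* Rows are stored interleaved: the pair of index 2k + 1 is (a_k, b_k) with
   a_k in cell 2k and b_k in cell 2k + 1. Constants: ireg 2 = 1, ireg 3 = 2,
   ireg 11 = 0, rreg 15 = 0. *)
Definition load_pair (i a b : nat) (p : program) : program :=
  Seq (Do (ISub 10 i 2)) (Seq (Do (RLoad a 10)) (Seq (Do (RLoad b i)) p)).

(* rreg c := (a_k - j b_k)^2, with j in rreg 2 *)
Definition load_residual (i c : nat) (p : program) : program :=
  load_pair i 4 5
    (Seq (Do (RMul 6 2 5)) (Seq (Do (RSub 6 4 6)) (Seq (Do (RMul c 6 6)) p))).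

(** There is no empty instruction; register 10 is scratch. *)
Definition skip : program := Do (IAdd 10 11 11).

Definition count_below : program :=
  Seq (Do (IConst 8 0))
    (for_pairs 7 (load_residual 7 9 (If (RLe 9 3) (Do (IAdd 8 8 2)) skip))).

Definition record_best : program :=
  Seq (Do (RAdd 0 2 15)) (Seq (Do (RAdd 1 3 15)) (Do (IConst 9 1))).

(** Two doublings compare 4 times the count with the 2 m0 in [ireg 0], which asks for at least half
    of the rows. Only residuals occurring at the point are tried as levels, because the best level
    is one of them. *)
Definition try_level : program :=
  load_residual 6 3 (Seq count_below
    (Seq (Do (IAdd 10 8 8)) (Seq (Do (IAdd 10 10 10))
      (If (ILe 0 10) (If (ILe 9 11) record_best (If (RLe 3 1) record_best skip)) skip)))).

Definition try_point : program := for_pairs 6 try_level.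

(** Equality of |a_k - j b_k| and |a_l - j b_l| splits into two linear equations. The choice k = l
    in the second gives the zero of a residual. A null denominator yields the harmless candidate
    0. *)
Definition try_crossings : program :=
  load_pair 4 7 8 (load_pair 5 10 11
    (Seq (Do (RSub 6 7 10)) (Seq (Do (RSub 9 8 11)) (Seq (Do (RDiv 2 6 9)) (Seq try_point
    (Seq (Do (RAdd 6 7 10)) (Seq (Do (RAdd 9 8 11)) (Seq (Do (RDiv 2 6 9)) try_point)))))))).

Definition median_program : program :=
  Seq (Do (IConst 2 1)) (Seq (Do (IConst 3 2))
    (for_pairs 4 (for_pairs 5 try_crossings))).

(** * Invariants of the program *)

Section median_program.
Variables (R : realType) (m0 : nat) (cells : nat -> R).
Implicit Types (s : state R) (D : R -> nat -> Prop).

Let a k := cells k.*2.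
Let b k := cells k.*2.+1.
(** Squares are ordered like absolute values and need no sign test. *)
Definition residual (j : R) k := (a k - j * b k) * (a k - j * b k).
Definition below (j v : R) k : nat := \sum_(q < k) (residual j q <= v)%R.
Definition feasible (j v : R) := (m0 <= 2 * below j v m0)%N.

Definition env s := [/\ ireg s 0 = m0.*2, ireg s 2 = 1%N, ireg s 3 = 2%N,
  ireg s 11 = 0%N & rreg s 15 = 0 /\ rmem s = cells].

Definition changes (ci cr : seq nat) s s' :=
  (forall x, x \notin ci -> ireg s' x = ireg s x) /\
  (forall x, x \notin cr -> rreg s' x = rreg s x).

(* rreg 0 and rreg 1 hold the current point and level, ireg 9 is 0 as long as
   there is none. *)
Definition best D s :=
  (forall j k, D j k -> feasible j (residual j k) ->
     (0 < ireg s 9)%N /\ rreg s 1 <= residual j k) /\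
  ((0 < ireg s 9)%N -> feasible (rreg s 0) (rreg s 1)).

Lemma changes_refl ci cr s : changes ci cr s s.
Proof. by []. Qed.

Lemma changes_trans ci cr ci1 cr1 ci2 cr2 s1 s2 s3 :
  changes ci1 cr1 s1 s2 -> changes ci2 cr2 s2 s3 ->
  all (mem ci) (ci1 ++ ci2) -> all (mem cr) (cr1 ++ cr2) -> changes ci cr s1 s3.
Proof.
move=> [i1 r1] [i2 r2]; rewrite !all_cat => /andP[/allP ci1s /allP ci2s].
move=> /andP[/allP cr1s /allP cr2s]; split=> x xn.
  by rewrite i2 ?i1 // (contra _ xn) // => [/ci1s|/ci2s].
by rewrite r2 ?r1 // (contra _ xn) // => [/cr1s|/cr2s].
Qed.

Lemma changes_set_ireg i v s : changes [:: i] [::] s (set_ireg s i v).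
Proof.
by split=> x //=; rewrite /update inE => /negbTE ->.
Qed.

Lemma best_eq D s s' : ireg s' 9 = ireg s 9 -> rreg s' 0 = rreg s 0 ->
  rreg s' 1 = rreg s 1 -> best D s -> best D s'.
Proof. by move=> e9 e0 e1 [h1 h2]; split; rewrite ?e9 ?e0 ?e1. Qed.

Lemma best_sub D D' s : (forall j k, D' j k -> D j k) -> best D s -> best D' s.
Proof. by move=> DD [h1 h2]; split=> // j k /DD; exact: h1. Qed.

Lemma runs_load_pair i x y k p T s Q : env s -> ireg s i = k.*2.+1 ->
  i != 10%N -> x \notin [:: 15; y]%N -> y != 15%N ->
  (forall s', env s' -> rreg s' x = a k -> rreg s' y = b k ->
    changes [:: 10%N] [:: x; y] s s' -> runs p T s' Q) ->
  runs (load_pair i x y p) (T + 3) s Q.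
Proof.
move=> [e0 e2 e3 e11 [e15 em]] ei /negbTE i10.
rewrite !inE negb_or => /andP[x15 xy] y15 H; rewrite !addnS addn0.
do 3! apply: runs_do_seq.
apply: H.
- split=> //=; split => //.
  by rewrite /update ![15%N == _]eq_sym (negbTE x15) (negbTE y15).
- by rewrite /= /update (negbTE xy) eqxx /= ei e2 subn1 em.
- by rewrite /= /update eqxx /= i10 ei em.
split=> z; rewrite !inE ?negb_or /= /update; first by move=> /negbTE ->.
by move=> /andP[/negbTE -> /negbTE ->].
Qed.

Lemma runs_load_residual i c k p T s Q : env s -> ireg s i = k.*2.+1 ->
  i != 10%N -> c \notin [:: 2; 15]%N ->
  (forall s', env s' -> rreg s' c = residual (rreg s 2) k ->
    changes [:: 10%N] [:: 4; 5; 6; c]%N s s' -> runs p T s' Q) ->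
  runs (load_residual i c p) (T + 6) s Q.
Proof.
move=> es ei i10 c2 H; rewrite (addnA T 3 3).
apply: runs_load_pair es ei i10 _ _ _ => // s1 es1 e4 e5 ch.
rewrite !addnS addn0; do 3! apply: runs_do_seq.
have e2 : rreg s1 2 = rreg s 2 by apply: ch.2.
move: c2; rewrite !inE negb_or => /andP[c2 c15].
apply: H.
- case: es1 => ? ? ? ? [? ?]; split=> //=; split=> //.
  by rewrite /update eq_sym (negbTE c15).
- by rewrite /= /update /= eqxx e4 e5 e2.
apply: (@changes_trans _ _ _ _ [::] [:: 6; c]%N _ _ _ ch) => //=.
  split=> z //=; rewrite !inE negb_or /update => /andP[/negbTE -> /negbTE -> //].
by rewrite !inE !eqxx !orbT.
Qed.

Lemma belowS j v k : below j v k.+1 = (below j v k + (residual j k <= v)%R)%N.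
Proof. by rewrite /below big_ord_recr. Qed.

Lemma env_changes ci cr s s' : env s -> changes ci cr s s' -> rmem s' = rmem s ->
  all (fun x => x \notin ci) [:: 0; 2; 3; 11]%N -> 15%N \notin cr -> env s'.
Proof.
move=> [e0 e2 e3 e11 [e15 em]] [h1 h2] hm /and5P[? ? ? ? _] ?.
by split; rewrite ?h1 // h2 // hm.
Qed.

Lemma runs_count_below s : env s ->
  runs count_below (m0 * 10 + 3) s (fun s' => [/\ env s',
    changes [:: 7; 8; 10]%N [:: 4; 5; 6; 9]%N s s' &
    ireg s' 8 = below (rreg s 2) (rreg s 3) m0]).
Proof.
move=> es; rewrite addnS; apply: runs_do_seq.
pose I k s' := [/\ env s', changes [:: 7; 8; 10]%N [:: 4; 5; 6; 9]%N s s',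
  ireg s' 7 = k.*2.+1 & ireg s' 8 = below (rreg s 2) (rreg s 3) k].
apply: (@runs_weaken _ _ (m0 * (2 + 6 + 2) + 2) _ _ (I m0)) => //.
  by move=> s' [].
apply: runs_for_pairs.
- have ch : changes [:: 7; 8; 10]%N [:: 4; 5; 6; 9]%N s
      (set_ireg (step (IConst 8 0) s) 7 1).
    by apply: (changes_trans (changes_set_ireg _ _ _) (changes_set_ireg _ _ _)).
  by split=> //; rewrite /below big_ord0.
- by move=> k s' [[? _ _ _ _] _ ? _].
move=> k s1 km [es1 ch1 e7 e8].
apply: (runs_load_residual es1 e7) => // s2 es2 e9 ch2.
have e7' : ireg s2 7 = k.*2.+1 by rewrite ch2.1.
have e8' : ireg s2 8 = below (rreg s 2) (rreg s 3) k by rewrite ch2.1.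
have e3 : rreg s2 3 = rreg s 3 by rewrite ch2.2 // ch1.2.
have e2 : rreg s1 2 = rreg s 2 by rewrite ch1.2.
have [e20 e22 e23 e211 [e215 em]] := es2.
have fin s3 : env s3 -> changes [:: 8; 10]%N [::] s2 s3 ->
    ireg s3 8 = below (rreg s 2) (rreg s 3) k.+1 ->
    [/\ ireg s3 3 = 2%N, ireg s3 7 = k.*2.+1 & I k.+1 (set_ireg s3 7 k.*2.+3)].
  move=> es3 ch3 e38; have [e30 e32 e33 e311 [e315 e3m]] := es3.
  split=> //; first by rewrite ch3.1.
  have := changes_set_ireg 7 k.*2.+3 s3; move: ch1 => /changes_trans.
  move=> /(_ [:: 7; 8; 10]%N [:: 4; 5; 6; 9]%N _ _ _ ch2 isT isT) /changes_trans.
  move=> /(_ [:: 7; 8; 10]%N [:: 4; 5; 6; 9]%N _ _ _ ch3 isT isT) /changes_trans.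
  move=> /[apply] => /(_ [:: 7; 8; 10]%N [:: 4; 5; 6; 9]%N isT isT) ch.
  by split=> //; by apply: (env_changes es ch).
apply: runs_if => /= h; apply: runs_do; apply: fin.
- by apply: (env_changes es2 (changes_set_ireg _ _ _)).
- by apply: (changes_trans (changes_set_ireg _ _ _) (changes_refl [::] [::] _)).
- by rewrite belowS /= /update /= e8' e22 -e2 -e9 -e3 h.
- by apply: (env_changes es2 (changes_set_ireg _ _ _)).
- by apply: (changes_trans (changes_set_ireg _ _ _) (changes_refl [::] [::] _)).
- by rewrite belowS /= /update /= e8' -e2 -e9 -e3 (negbTE h) addn0.
Qed.

Lemma runs_try_level D k s : env s -> ireg s 6 = k.*2.+1 -> (k < m0)%N -> best D s ->
  runs try_level (m0 * 10 + 17) s (fun s' => [/\ env s',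
    changes [:: 7; 8; 9; 10]%N [:: 0; 1; 3; 4; 5; 6; 9]%N s s' &
    best (fun j k' => D j k' \/ j = rreg s 2 /\ k' = k) s']).
Proof.
move=> es e6 km bs.
apply: (@runs_le _ _ (m0 * 10 + 3 + 8 + 6)); first by lia.
rewrite /try_level; apply: (runs_load_residual es e6) => // s1 es1 e3 ch1.
apply: runs_seq; have [u [s2 [x2 u2 [es2 ch2 e8]]]] := runs_count_below es1.
exists u, s2; split=> // {u x2 u2}.
have e2 : rreg s2 2 = rreg s 2 by rewrite ch2.2 // ch1.2.
have e3' : rreg s2 3 = residual (rreg s 2) k by rewrite ch2.2.
have bs2 : best D s2.
  by apply: best_eq bs; rewrite ?(ch2.1, ch2.2) ?(ch1.1, ch1.2).
have ch : changes [:: 7; 8; 9; 10]%N [:: 0; 1; 3; 4; 5; 6; 9]%N s s2.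
  exact: (changes_trans ch1 ch2).
have {}e8 : ireg s2 8 = below (rreg s 2) (rreg s2 3) m0.
  by rewrite e8 e3' e3 ch1.2.
do 2! apply: runs_do_seq; set s3 := step _ _.
have ch3 : changes [:: 10]%N [::] s2 s3.
  exact: (changes_trans (changes_set_ireg _ _ _) (changes_set_ireg _ _ _)).
have es3 : env s3 by apply: (env_changes es2 ch3).
have bs3 : best D s3 by exact: best_eq bs2.
have e10 : ireg s3 10 = (4 * ireg s2 8)%N by rewrite /= /update /=; lia.
have e33 : rreg s3 3 = residual (rreg s 2) k by [].
have e32 : rreg s3 2 = rreg s 2 by [].
have chs3 := changes_trans ch ch3.
have {}chs3 := chs3 [:: 7; 8; 9; 10]%N [:: 0; 1; 3; 4; 5; 6; 9]%N isT isT.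
have [e0 _ _ e11 [e15 em]] := es3.
have ifeas : (ireg s3 0 <= ireg s3 10)%N = feasible (rreg s 2) (residual (rreg s 2) k).
  by rewrite e0 e10 e8 e3' /feasible; apply/idP/idP; lia.
move: {e8 e10 ch1 ch2 ch3 es1 es2 bs2 ch e2 e3 e3'} s3 ifeas es3 bs3 e33 e32 chs3 e0 e11 e15 em.
move=> s3 ifeas es3 bs3 e33 e32 chs3 e0 e11 e15 em.
have noop : ((0 < ireg s3 9)%N -> feasible (rreg s 2) (residual (rreg s 2) k) ->
      rreg s3 1 <= residual (rreg s 2) k) ->
    (feasible (rreg s 2) (residual (rreg s 2) k) -> (0 < ireg s3 9)%N) ->
    runs skip 1 s3 (fun s' => [/\ env s',
      changes [:: 7; 8; 9; 10]%N [:: 0; 1; 3; 4; 5; 6; 9]%N s s' &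
      best (fun j k' => D j k' \/ j = rreg s 2 /\ k' = k) s']).
  move=> hle h9; apply: runs_do.
  have ch4 := changes_set_ireg 10 (ireg s3 11 + ireg s3 11) s3.
  split; [by apply: (env_changes es3 ch4)|exact: (changes_trans chs3 ch4)|].
  apply: (@best_eq _ s3) => //; case: bs3 => b1 b2; split=> // j k' [|[-> ->]].
    exact: b1.
  by move=> hf; split; [exact: h9|exact: hle (h9 hf) hf].
have rec : feasible (rreg s 2) (residual (rreg s 2) k) ->
    ((0 < ireg s3 9)%N -> residual (rreg s 2) k <= rreg s3 1) ->
    runs record_best 3 s3 (fun s' => [/\ env s',
      changes [:: 7; 8; 9; 10]%N [:: 0; 1; 3; 4; 5; 6; 9]%N s s' &
      best (fun j k' => D j k' \/ j = rreg s 2 /\ k' = k) s']).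
  move=> hf hle; do 2! apply: runs_do_seq; apply: runs_do; set s4 := step _ _.
  have ch4 : changes [:: 9]%N [:: 0; 1]%N s3 s4.
    split=> x //=; rewrite !inE /update ?negb_or; first by move=> /negbTE ->.
    by move=> /andP[/negbTE -> /negbTE ->].
  have e40 : rreg s4 0 = rreg s 2 by rewrite /= /update /= e15 addr0.
  have e41 : rreg s4 1 = residual (rreg s 2) k by rewrite /= /update /= e15 addr0.
  split; [by apply: (env_changes es3 ch4)|exact: (changes_trans chs3 ch4)|].
  case: bs3 => b1 b2; split; rewrite ?e40 ?e41 // => j k' [Djk|[-> ->]] hf'; last by [].
  by have [h9 h1] := b1 _ _ Djk hf'; split=> //; exact: le_trans (hle h9) h1.
apply: runs_if => /=; rewrite ifeas => hf; last first.
  apply: (@runs_le _ _ 1) => //; apply: noop => [_ hf'|hf']; by rewrite hf' in hf.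
apply: runs_if => /=; rewrite e11 => h9.
  apply: (@runs_le _ _ 3) => //; apply: rec => //; lia.
apply: runs_if => /=; rewrite e33 => hle; first exact: rec.
apply: (@runs_le _ _ 1) => //; apply: noop => [_ _|_]; last by lia.
by rewrite ltW // ltNge.
Qed.

Lemma runs_try_point D s : env s -> best D s ->
  runs try_point (m0 * (m0 * 10 + 19) + 2) s (fun s' => [/\ env s',
    changes [:: 6; 7; 8; 9; 10]%N [:: 0; 1; 3; 4; 5; 6; 9]%N s s' &
    best (fun j k => D j k \/ j = rreg s 2 /\ (k < m0)%N) s']).
Proof.
move=> es bs.
pose I k s' := [/\ env s', changes [:: 6; 7; 8; 9; 10]%N [:: 0; 1; 3; 4; 5; 6; 9]%N s s',
  ireg s' 6 = k.*2.+1 & best (fun j k' => D j k' \/ j = rreg s 2 /\ (k' < k)%N) s'].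
apply: (@runs_weaken _ _ (m0 * (m0 * 10 + 17 + 2) + 2) _ _ (I m0)) => //; first by lia.
  by move=> s' [].
apply: runs_for_pairs.
- have ch := changes_set_ireg 6 1 s.
  split=> //.
    by apply: (changes_trans ch (changes_refl [::] [::] _)).
  by apply: (@best_eq _ s) => //; apply: best_sub bs => j k [//|[_]].
- by move=> k s' [[? _ _ _ _] _ ? _].
move=> k s1 km [es1 ch1 e6 bs1].
have := runs_try_level es1 e6 km bs1.
apply: runs_weaken => // s2 [es2 ch2 bs2].
have ch := changes_trans ch1 ch2.
have {}ch := ch [:: 6; 7; 8; 9; 10]%N [:: 0; 1; 3; 4; 5; 6; 9]%N isT isT.
have ch3 := changes_set_ireg 6 k.*2.+3 s2.
split; [by case: es2|by rewrite ch2.1|split=> //].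
- exact: (changes_trans ch ch3).
apply: (@best_eq _ s2) => //; apply: best_sub bs2 => j k' [Djk|[-> ]].
  by left; left.
rewrite ltnS leq_eqVlt => /orP[/eqP->|kk]; last by left; right.
by right; rewrite ch1.2.
Qed.

Definition crossing (j : R) k l :=
  j = (a k - a l) / (b k - b l) \/ j = (a k + a l) / (b k + b l).

Lemma runs_try_crossings D k l s : env s -> best D s ->
  ireg s 4 = k.*2.+1 -> ireg s 5 = l.*2.+1 ->
  runs try_crossings (2 * (m0 * (m0 * 10 + 19)) + 16) s (fun s' => [/\ env s',
    changes [:: 6; 7; 8; 9; 10]%N (iota 0 12) s s' &
    best (fun j k' => D j k' \/ crossing j k l /\ (k' < m0)%N) s']).
Proof.
move=> es bs e4 e5; set t := (m0 * _)%N.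
apply: (@runs_le _ _ ((t + 2 + (t + 2).+3).+3 + 3 + 3)); first by lia.
rewrite /try_crossings; apply: (runs_load_pair es e4) => // s1 es1 a1 b1 ch1.
have e5' : ireg s1 5 = l.*2.+1 by rewrite ch1.1.
apply: (runs_load_pair es1 e5') => // s2 es2 a2 b2 ch2.
have c2 : changes [:: 6; 7; 8; 9; 10]%N (iota 0 12) s s2 by exact: (changes_trans ch1 ch2).
have bs2 : best D s2 by apply: best_eq bs; rewrite ?(ch2.1, ch2.2) ?(ch1.1, ch1.2).
have r7 : rreg s2 7 = a k by rewrite ch2.2.
have r8 : rreg s2 8 = b k by rewrite ch2.2.
do 3! apply: runs_do_seq; set s3 := step _ _.
have ch3 : changes [::] [:: 6; 9; 2]%N s2 s3.
  split=> x //=; rewrite !inE /update !negb_or.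
  by move=> /and3P[/negbTE -> /negbTE -> /negbTE ->].
have r32 : rreg s3 2 = (a k - a l) / (b k - b l).
  by rewrite /= /update /= r7 r8 a2 b2.
have es3 : env s3 by apply: (env_changes es2 ch3).
have bs3 : best D s3 by apply: best_eq bs2.
move: s3 ch3 r32 es3 bs3 => s3 ch3 r32 es3 bs3.
apply: runs_seq; have := runs_try_point es3 bs3; apply: runs_weaken => //.
move=> s4 [es4 ch4 bs4].
have c3 : changes [:: 6; 7; 8; 9; 10]%N (iota 0 12) s s3 by exact: (changes_trans c2 ch3).
have c4 : changes [:: 6; 7; 8; 9; 10]%N (iota 0 12) s s4 by exact: (changes_trans c3 ch4).
have h7 : rreg s4 7 = a k by rewrite ch4.2 // ch3.2.
have h8 : rreg s4 8 = b k by rewrite ch4.2 // ch3.2.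
have h10 : rreg s4 10 = a l by rewrite ch4.2 // ch3.2.
have h11 : rreg s4 11 = b l by rewrite ch4.2 // ch3.2.
do 3! apply: runs_do_seq; set s5 := step _ _.
have ch5 : changes [::] [:: 6; 9; 2]%N s4 s5.
  split=> x //=; rewrite !inE /update !negb_or.
  by move=> /and3P[/negbTE -> /negbTE -> /negbTE ->].
have r52 : rreg s5 2 = (a k + a l) / (b k + b l).
  by rewrite /= /update /= h7 h8 h10 h11.
have es5 : env s5 by apply: (env_changes es4 ch5).
have bs5 : best (fun j k' => D j k' \/ j = rreg s3 2 /\ (k' < m0)%N) s5.
  by apply: best_eq bs4.
move: s5 ch5 r52 es5 bs5 => s5 ch5 r52 es5 bs5.
have := runs_try_point es5 bs5; apply: runs_weaken => // s6 [es6 ch6 bs6].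
have c5 : changes [:: 6; 7; 8; 9; 10]%N (iota 0 12) s s5 by exact: (changes_trans c4 ch5).
split=> //; first exact: (changes_trans c5 ch6).
apply: best_sub bs6 => j k' [Djk|[[->|->] km]].
- by left; left.
- by left; right; rewrite r32.
- by right; rewrite r52.
Qed.

Lemma runs_median_program s : ireg s 0 = m0.*2 -> ireg s 9 = 0%N -> ireg s 11 = 0%N ->
  rreg s 15 = 0 -> rmem s = cells ->
  runs median_program (m0 * (m0 * (2 * (m0 * (m0 * 10 + 19)) + 18) + 4) + 4) s
    (best (fun j p => (exists k l, [/\ crossing j k l, k < m0 & l < m0]%N) /\ (p < m0)%N)).
Proof.
move=> e0 e9 e11 e15 em; pose t := (2 * (m0 * (m0 * 10 + 19)) + 16)%N.
apply: (@runs_le _ _ (m0 * (m0 * (t + 2) + 2 + 2) + 2).+2); first by rewrite /t; lia.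
do 2! apply: runs_do_seq; set s0 := step _ _.
have es0 : env s0 by split.
have bs0 : best (fun _ _ => False) s0 by split=> //=; rewrite /update /= e9.
move: s0 es0 bs0 => s0 es0 bs0.
pose I k s' := [/\ env s', ireg s' 4 = k.*2.+1 & best (fun j p =>
  (exists k' l, [/\ crossing j k' l, k' < k & l < m0]%N) /\ (p < m0)%N) s'].
apply: (@runs_weaken _ _ (m0 * (m0 * (t + 2) + 2 + 2) + 2) _ _ (I m0)) => //.
  by move=> s' [].
apply: runs_for_pairs.
- split=> //.
  by apply: (@best_eq _ s0) => //; apply: best_sub bs0 => j p [[k [l []]]].
- by move=> k s' [[? _ _ _ _] ? _].
move=> k s1 km [es1 e4 bs1].
(* The pairs already tried are those lexicographically below (k, l). *)
pose J l s' := [/\ env s', ireg s' 4 = k.*2.+1, ireg s' 5 = l.*2.+1 & best (fun j p =>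
  (exists k' l', [/\ crossing j k' l', l' < m0 & (k' < k) || (k' == k) && (l' < l)]%N)
   /\ (p < m0)%N) s'].
apply: (@runs_weaken _ _ (m0 * (t + 2) + 2) _ _ (J m0)) => //.
  move=> s2 [es2 e42 e5 bs2]; split=> //; first by case: es2.
  split=> //.
  apply: (@best_eq _ s2) => //; apply: best_sub bs2 => j p [[k' [l' [cr kk lm]]] pm].
  split=> //; exists k', l'; split=> //; move: kk; rewrite ltnS leq_eqVlt.
  by case/orP => ->; rewrite ?orbT ?lm // ?orbT.
apply: runs_for_pairs.
- split=> //.
  apply: (@best_eq _ s1) => //; apply: best_sub bs1 => j p [[k' [l' [cr lm kk]]] pm].
  split=> //; exists k', l'; split=> //.
  by move: kk; rewrite ltn0 andbF orbF.
- by move=> l s' [[? _ _ _ _] _ ? _].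
move=> l s2 lm [es2 e42 e5 bs2].
have := runs_try_crossings es2 bs2 e42 e5; apply: runs_weaken => //.
move=> s3 [es3 ch3 bs3]; split=> //; [by case: es3|by rewrite ch3.1|].
split=> //; first by rewrite /= /update /= ch3.1.
apply: (@best_eq _ s3) => //; apply: best_sub bs3 => j p [[k' [l' [cr l'm kk]]] pm].
move: kk; rewrite ltnS [(l' <= l)%N]leq_eqVlt => /orP[k'k|/andP[/eqP k'k /orP[/eqP l'l|l'l]]].
- by left; split=> //; exists k', l'; rewrite k'k.
- by right; rewrite -k'k -l'l.
- by left; split=> //; exists k', l'; split=> //; rewrite k'k eqxx l'l orbT.
Qed.

End median_program.

(** * Optimality of the crossings *)

Section crossing_optimal.
Variables (R : realType) (I : finType) (a b : I -> R).

Let z i x := a i - x * b i.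

Let point (t : I * I * bool) : R :=
  let: (k, l, e) := t in
  if e then (a k - a l) / (b k - b l) else (a k + a l) / (b k + b l).

(* Moving from [j] in a direction that does not increase the largest of the
   |z i j|, [i] in [S], this index stays the largest up to the next crossing. *)
Lemma exists_crossing_le (S : pred I) (i0 : I) (j : R) : S i0 ->
  exists t k, S k /\ forall i, S i -> z i (point t) * z i (point t) <= z k j * z k j.
Proof.
move=> Si0.
have [k Sk kmax] : exists2 k, S k & forall i, S i -> z i j * z i j <= z k j * z k j.
  case: (Order.TotalTheory.arg_maxP (fun i => z i j * z i j) Si0) => k Sk h.
  by exists k.
have [/existsP[t /eqP jt]|jN] := boolP [exists t, j == point t].
  by exists t, k; rewrite -jt.
have {}jN t : j != point t by apply: contra jN => h; apply/existsP; exists t.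
have zpt i : b i != 0 -> point (i, i, false) = a i / b i.
  move=> bi; rewrite /= -!mulr2n -[a i *+ 2]mulr_natl -[b i *+ 2]mulr_natl.
  by rewrite -mulf_div divff ?mul1r ?pnatr_eq0.
have [/forallP b0|] := boolP [forall i, S i ==> (b i == 0)].
  exists (k, k, false), k; split=> // i Si; have := b0 i; rewrite Si => /eqP bi.
  by have := kmax _ Si; rewrite /z bi !mulr0.
rewrite negb_forall => /existsP[l]; rewrite negb_imply => /andP[Sl bl].
(* If z k varies, the motion is towards its zero; otherwise z k is constant and any crossing gives a
   direction. [tm] is the position on this path, 0 at j and 1 at the zero of z l', and t is the
   first crossing met. *)
pose l' := if b k == 0 then l else k.
have bl' : b l' != 0 by rewrite /l'; case: ifP => // ->.
pose D := point (l', l', false) - j.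
have D0 : D != 0 by rewrite subr_eq0 eq_sym.
pose tm t := (point t - j) / D.
have tmE t : point t = j + tm t * D by rewrite divfK // addrC subrK.
pose P t := 0 < tm t <= 1.
have P0 : P (l', l', false) by rewrite /P /tm divff // ltr01 lexx.
case: (Order.TotalTheory.arg_minP tm P0) => t /andP[t0 t1] tmin.
exists t, k; split=> // i Si.
(* A crossing cannot lie strictly between [j] and [point t]. *)
have lin s (A B : R) : point s = A / B ->
    [/\ 0 <= (A - j * B) * (A - point t * B) &
        A - j * B = 0 -> A - point t * B = 0].
  move=> sE; have [->|B0] := eqVneq B 0.
    by rewrite !mulr0 !subr0; split=> //; rewrite -expr2 sqr_ge0.
  have AE : A = point s * B by rewrite sE divfK.
  rewrite AE -!mulrBl; split; last first.
    by move/eqP; rewrite mulf_eq0 (negbTE B0) orbF subr_eq0 eq_sym (negbTE (jN s)).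
  have s0 : tm s != 0.
    by rewrite mulf_neq0 ?invr_eq0 // subr_eq0 eq_sym.
  have st : 0 <= tm s * (tm s - tm t).
    have [s_le0|s_gt0] := leP (tm s) 0; first nra.
    have [s1|s1] := leP (tm s) 1; last nra.
    have : tm t <= tm s by apply: tmin; rewrite /P s_gt0.
    nra.
  have -> : (point s - j) * B * ((point s - point t) * B) =
      B ^+ 2 * D ^+ 2 * (tm s * (tm s - tm t)).
    by rewrite (tmE s) (tmE t); ring.
  by rewrite mulr_ge0 // mulr_ge0 // sqr_ge0.
have [m1 n1] := lin (k, i, true) (a k - a i) (b k - b i) erefl.
have [m2 n2] := lin (k, i, false) (a k + a i) (b k + b i) erefl.
(* The difference of squares factors into two affine functions of the point that vanish at
   crossings; by [lin], neither changes sign on the way. *)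
have h1 : z i (point t) * z i (point t) <= z k (point t) * z k (point t).
  have := kmax _ Si; rewrite /z.
  set x := point t in m1 n1 m2 n2 *.
  rewrite -subr_ge0 => hj; rewrite -subr_ge0.
  have e1 y : (a k - y * b k) * (a k - y * b k) - (a i - y * b i) * (a i - y * b i) =
    (a k - a i - y * (b k - b i)) * (a k + a i - y * (b k + b i)) by ring.
  move: hj; rewrite !e1.
  move: (a k - a i - j * _) (a k + a i - j * _) m1 n1 m2 n2 => g1 g2.
  move: (a k - a i - x * _) (a k + a i - x * _) => g1' g2' m1 n1 m2 n2 g12.
  have [/n1 ->|g10] := eqVneq g1 0; first by rewrite mul0r.
  have [/n2 ->|g20] := eqVneq g2 0; first by rewrite mulr0.
  have g12' : 0 < g1 * g2 by rewrite lt_def g12 mulf_neq0.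
  rewrite -(pmulr_rge0 _ g12') mulrACA; exact: mulr_ge0.
apply: le_trans h1 _.
have [bk|bk] := eqVneq (b k) 0; first by rewrite /z bk !mulr0.
have zk : z k (point t) = (1 - tm t) * z k j.
  rewrite tmE /z /D zpt //; rewrite /l' (negbTE bk); by field.
rewrite zk mulrACA ler_piMl //; first by rewrite -expr2 sqr_ge0.
by rewrite mulr_ile1 ?subr_ge0 // lerBlDr lerDl ltW.
Qed.

End crossing_optimal.

Section median_program_spec.
Variables (R : realType) (m0 : nat) (cells : nat -> R).
Hypothesis m0_gt0 : (0 < m0)%N.

Lemma below_card (j v : R) : below cells j v m0 =
  #|[pred q : 'I_m0 | residual cells j q <= v]|.
Proof.
rewrite /below -sum1_card [RHS]big_mkcond; apply: eq_bigr => q _.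
by rewrite inE; case: ifP.
Qed.

(** Let S be the rows counted at j. At the crossing c all of S stays at or below v, and the largest
    residual of S at c is a level that still counts all of S. *)
Lemma feasible_crossing (j v : R) : feasible m0 cells j v ->
  exists c k l p, [/\ crossing cells c k l, (k < m0)%N, (l < m0)%N, (p < m0)%N &
    feasible m0 cells c (residual cells c p) /\ residual cells c p <= v].
Proof.
rewrite /feasible below_card => h.
set S := [pred q : 'I_m0 | residual cells j q <= v] in h.
have /card_gt0P[i0 Si0] : (0 < #|S|)%N by lia.
have [[[k l] e] [q [Sq H]]] := @exists_crossing_le R 'I_m0 (fun i => cells i.*2)
  (fun i => cells i.*2.+1) S i0 j Si0.
set c := (if e then _ else _) in H.
case: (Order.TotalTheory.arg_maxP (fun i : 'I_m0 => residual cells c i) Si0) => p Sp pmax.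
exists c, k, l, p; split=> //.
  by rewrite /crossing /c; case: (e); [left|right].
split; last by apply: le_trans (H p Sp) Sq.
rewrite below_card; apply: leq_trans h _; rewrite leq_mul2l /=.
by apply: subset_leq_card; apply/fintype.subsetP => i /pmax.
Qed.

(** This is minimality of the median residual at the output, phrased through levels so that the
    median itself need not be defined. It follows because feasibility is monotone in the level. *)
Lemma median_program_spec (s : state R) :
  ireg s 0 = m0.*2 -> ireg s 9 = 0%N -> ireg s 11 = 0%N -> rreg s 15 = 0 ->
  rmem s = cells ->
  runs median_program (m0 * (m0 * (2 * (m0 * (m0 * 10 + 19)) + 18) + 4) + 4) s
    (fun s' => forall j v, feasible m0 cells j v -> feasible m0 cells (rreg s' 0) v).
Proof.
move=> e0 e9 e11 e15 em.
apply: runs_weaken (runs_median_program e0 e9 e11 e15 em) => // s' [b1 b2] j v.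
move=> /feasible_crossing[c [k [l [p [cr km lm pm [fc rc]]]]]].
have [h9 h1] := b1 c p (conj (ex_intro _ k (ex_intro _ l (And3 cr km lm))) pm) fc.
apply: leq_trans (b2 h9) _; rewrite leq_mul2l /= !below_card.
apply: subset_leq_card; apply/fintype.subsetP => i; rewrite !inE => /le_trans; apply.
exact: le_trans h1 rc.
Qed.

End median_program_spec.

(** * Analysis of the decoder *)

Section uniform_nat.
Variable R : realType.

(** The finite sample space is enumerated inside [nat], where every set is measurable. *)
Definition uniform_nat (K : nat) : set nat -> \bar R :=
  mscale (K.+1%:R^-1)%:nng (msum (fun i => \d_i) K.+1).

HB.instance Definition _ K := Measure.on (uniform_nat K).

Lemma uniform_natE K (A : set nat) :
  uniform_nat K A = (K.+1%:R^-1 * \sum_(i < K.+1) ((i : nat) \in A)%:R)%:E.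
Proof.
by rewrite /uniform_nat /mscale /msum /= EFinM -sumEFin.
Qed.

Lemma uniform_nat_setT K : uniform_nat K setT = 1%E.
Proof.
rewrite uniform_natE (eq_bigr (fun=> 1)); last by move=> i _; rewrite in_setT.
by rewrite sumr_const card_ord mulVf // pnatr_eq0.
Qed.

HB.instance Definition _ K :=
  Measure_isProbability.Build _ _ _ (uniform_nat K) (uniform_nat_setT K).

End uniform_nat.

Section union_bound.
Variables (R : realType) (X J : finType) (A : J -> pred X) (m : nat) (d : R).
Hypotheses (X0 : (0 < #|X|)%N) (d0 : 0 <= d).
Hypothesis rareA : forall e, \sum_x (A e x)%:R <= (2^-1 - d) * #|X|%:R :> R.

Definition some_majority (w : {ffun 'I_m -> X}) :=
  [exists e, (m <= 2 * #|[pred k | A e (w k)]|)%N].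

Lemma some_majority_rare : \sum_w (some_majority w)%:R <=
  #|J|%:R * (1 - d ^+ 2) ^+ m * #|{ffun 'I_m -> X}|%:R :> R.
Proof.
apply: (@le_trans _ _ (\sum_(w : {ffun 'I_m -> X})
    \sum_e (m <= 2 * #|[pred k | A e (w k)]|)%N%:R)).
  apply: ler_sum => w _; rewrite /some_majority.
  case: existsP => [[e he]|_] /=; last exact: sumr_ge0.
  by rewrite (bigD1 e) //= he lerDl sumr_ge0.
rewrite exchange_big /= -mulrA mulr_natl -sumr_const.
by apply: ler_sum => e _; exact: majority_rare.
Qed.

End union_bound.

(** * From rare events to a near-optimal output *)

Section decoding.
Variables (R : realType) (n k : nat) (x : 'cV[R]_n) (eta js : R) (L : nat).
Local Notation Row := {ffun 'I_n -> 'I_(2 ^ k)}.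

Definition dir (j : R) (i : 'I_n) : R := x i 0 * (i.+1%:R - j).
Definition resid (j : R) (f : Row) : R := dot (dir j) f.
Definition mass_dot (f : Row) : R := dot (fun i => x i 0) f.
Definition mass : R := \sum_i `|x i 0|.
Local Notation c := (cost x).

Lemma sum_dir j : \sum_i `|dir j i| = c j.
Proof. by apply: eq_bigr => i _; rewrite normrM. Qed.

Lemma residB (j j' : R) f : resid j' f = resid j f + (j - j') * mass_dot f.
Proof.
rewrite /resid /mass_dot /dot mulr_sumr -big_split /=; apply: eq_bigr => i _.
by rewrite /dir; ring.
Qed.

Lemma cost_lip (j j' : R) : c j' <= c j + `|j - j'| * mass.
Proof.
rewrite /cost /mass mulr_sumr -big_split /=; apply: ler_sum => i _.
rewrite [X in _ <= _ + X]mulrC -mulrDr ler_wpM2l //.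
by apply: le_trans (ler_normD _ _); rewrite addrA subrK.
Qed.

(** Chosen so that a move by [spacing], with slope at most 10 / eta * mass, changes a residual by at
    most eta * cost js. *)
Definition spacing : R := eta ^+ 2 * c js / (10 * mass).

Definition net_point (p : bool * 'I_L) : R :=
  js + (if p.1 then spacing * p.2%:R else - (spacing * p.2%:R)).

(* The event of [inl true] bounds the median residual at [js]; that of [inl false]
   keeps a minimizer at distance O(cost js / mass) of [js]; that of [inr p] keeps
   it away from the net point [p] if this point is bad, the second disjunct
   covering the points within [spacing] of it. *)
Definition unlikely (e : bool + bool * 'I_L) (f : Row) : bool :=
  match e with
  | inl true => (1 + eta) * c js < `|resid js f|
  | inl false => (`|mass_dot f| <= 8^-1 * mass) || (8 * c js < `|resid js f|)
  | inr p => (`|resid (net_point p) f| < (1 - eta) * c (net_point p))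
             || (10 / eta * mass < `|mass_dot f|)
  end.

Lemma majority_meets (m : nat) (S B : pred 'I_m) :
  (m <= 2 * #|S|)%N -> (2 * #|B| < m)%N -> exists2 i, S i & ~~ B i.
Proof.
move=> mS Bm; apply/exists_inP; apply: contraLR Bm => /exists_inPn SB.
rewrite -leqNgt; apply: leq_trans mS _; rewrite leq_mul2l /=.
by apply: subset_leq_card; apply/fintype.subsetP => i /SB; rewrite negbK.
Qed.

Lemma decode_near_optimal (m : nat) (w : {ffun 'I_m -> Row}) (jh : R) :
  0 < eta -> eta <= 10^-1 -> 0 < mass -> 730 / eta ^+ 2 < L%:R ->
  ~~ some_majority unlikely w ->
  (forall j v, (m <= 2 * #|[pred i | (resid j (w i) ^+ 2 <= v)%R]|)%N ->
               (m <= 2 * #|[pred i | (resid jh (w i) ^+ 2 <= v)%R]|)%N) ->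
  c jh <= (1 + 10 * eta) * c js.
Proof.
move=> eta0 eta1 mass0 LL /existsPn good opt.
have {}good e : (2 * #|[pred i | unlikely e (w i)]| < m)%N by rewrite ltnNge.
set C := c js; have C0 : 0 <= C by apply: sumr_ge0 => i _; rewrite mulr_ge0.
have le_sqr y : (y ^+ 2 <= ((1 + eta) * C) ^+ 2) = (`|y| <= (1 + eta) * C).
  rewrite -(real_normK (num_real y)) ler_pXn2r // nnegrE.
  by rewrite mulr_ge0 // addr_ge0 // ltW.
have maj : (m <= 2 * #|[pred i | (`|resid jh (w i)| <= (1 + eta) * C)%R]|)%N.
  have E j : #|[pred i | resid j (w i) ^+ 2 <= ((1 + eta) * C) ^+ 2]| =
      #|[pred i | `|resid j (w i)| <= (1 + eta) * C]|.
    by apply: eq_card => i; rewrite !inE le_sqr.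
  have := opt js (((1 + eta) * C) ^+ 2); rewrite !E; apply.
  have rm := good (inl true).
  have Sm : (#|[pred i | (`|resid js (w i)| <= (1 + eta) * C)%R]|
      + #|[pred i | unlikely (inl true) (w i)]| = m)%N.
    rewrite -[RHS]card_ord -(cardC [pred i | (`|resid js (w i)| <= (1 + eta) * C)%R]).
    by congr addn; apply: eq_card => i; rewrite !inE /= ltNge.
  move: rm Sm; set p := #|_|; set q := #|_|; clearbody p q; lia.
have jh_near : `|jh - js| * mass <= 73 * C.
  (* Comparing this row at [js] and [jh] bounds |jh - js| |b| by (9 + eta) C, where |b| > mass / 8;
     and 8 (9 + eta) <= 73. *)
  have [i /= si] := majority_meets maj (good (inl false)).
  rewrite negb_or -!ltNge -leNgt => /andP[b8 z8].
  have : `|jh - js| * `|mass_dot (w i)| <= 8 * C + (1 + eta) * C.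
    rewrite -normrM; apply: le_trans (lerD z8 si).
    apply: le_trans (ler_normB _ _); rewrite (residB js jh) opprD addNKr.
    by rewrite -mulNr opprB.
  have : `|jh - js| * (8^-1 * mass) <= `|jh - js| * `|mass_dot (w i)|.
    by rewrite ler_wpM2l // ltW.
  have : eta * C <= 10^-1 * C by rewrite ler_wpM2r.
  lra.
(* When C = 0 the net collapses, but [jh_near] already gives jh = js. *)
have [CE|C1] := eqVneq C 0.
  move: jh_near; rewrite CE mulr0 pmulr_lle0 // normr_le0 subr_eq0 => /eqP ->.
  by rewrite -/C CE mulr0.
have {C1} C1 : 0 < C by rewrite lt_def C1.
have h0 : 0 < spacing by rewrite /spacing -/C divr_gt0 ?mulr_gt0 ?exprn_gt0.
set y := `|jh - js|; have y0 : 0 <= y by exact: normr_ge0.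
pose t := Num.truncn (y / spacing).
(* The distance 73 C / mass amounts to 730 / eta^2 spacings. *)
have tL : (t < L)%N.
  rewrite -(ltr_nat R); apply: le_lt_trans LL.
  apply: (@le_trans _ _ (y / spacing)); first by rewrite truncn_le divr_ge0 // ltW.
  rewrite ler_pdivrMr // /spacing -/C.
  have -> : 730 / eta ^+ 2 * (eta ^+ 2 * C / (10 * mass)) = 73 * C / mass.
    by field; rewrite !gt_eqF.
  by rewrite ler_pdivlMr.
have [p gp] : exists p, `|jh - net_point p| <= spacing.
  have /truncn_itv/andP[t1 t2] : 0 <= y / spacing by rewrite divr_ge0 // ltW.
  have {}t1 : spacing * t%:R <= y by rewrite mulrC -ler_pdivlMr.
  have {}t2 : y < spacing * t%:R + spacing.
    by move: t2; rewrite ltr_pdivrMr // -natr1 mulrDl mul1r mulrC.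
  exists (js <= jh, Ordinal tL); rewrite /net_point /= ler_norml.
  move: t1 t2; rewrite /y; case: (leP js jh) => jl.
    rewrite ger0_norm ?subr_ge0 // => t1 t2; apply/andP; split; lra.
  rewrite ltr0_norm ?subr_lt0 // => t1 t2; apply/andP; split; lra.
set g := net_point p in gp.
have [i /= si] := majority_meets maj (good (inr p)).
rewrite negb_or -!leNgt -/g => /andP[zg bi].
(* One row serves both points: its residual is small at [jh], hence at the nearby g, where it is at
   least (1 - eta) times the cost. No union over the random [jh] is needed. *)
have key : (1 - eta) * c g <= (1 + 2 * eta) * C.
  apply: le_trans zg _; rewrite (residB jh g).
  apply: le_trans (ler_normD _ _) _; rewrite normrM.
  have : `|jh - g| * `|mass_dot (w i)| <= spacing * (10 / eta * mass).
    exact: ler_pM.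
  have -> : spacing * (10 / eta * mass) = eta * C.
    by rewrite /spacing -/C; field; rewrite !gt_eqF.
  by move: si; lra.
have lip := cost_lip g jh.
have hX : spacing * mass = eta ^+ 2 * C / 10.
  rewrite /spacing -/C; field; by rewrite gt_eqF.
have : `|g - jh| * mass <= eta ^+ 2 * C / 10.
  by rewrite -hX ler_pM2r // distrC.
move: lip; set cg := c g in key *; set ch := c jh; set D := _ * mass => lip hD.
have e1 : 0 < 1 - eta by lra.
have chle : ch <= cg + eta ^+ 2 * C / 10 by lra.
rewrite -(ler_pM2l e1); apply: le_trans (ler_wpM2l (ltW e1) chle) _.
rewrite mulrDr; apply: le_trans (lerD key (lexx _)) _; rewrite -subr_ge0.
rewrite (_ : _ - _ = C * (eta * (7 - 10 * eta - eta / 10 + eta ^+ 2 / 10))); last by field.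
by rewrite mulr_ge0 // mulr_ge0 ?(ltW eta0) // addr_ge0 ?divr_ge0 ?sqr_ge0 //; lra.
Qed.

Lemma sum_orb_le (X : finType) (p q : pred X) :
  \sum_f (p f || q f)%:R <= \sum_f (p f)%:R + \sum_f (q f)%:R :> R.
Proof.
by rewrite -big_split; apply: ler_sum => f _; case: (p f); case: (q f);
  rewrite /= ?addr0 ?add0r // lerDl.
Qed.

Lemma two_div_pi (y : R) : 0 <= y -> y / 2 <= 2 / pi * y <= y.
Proof.
move=> y0; have p0 := pi_gt0 R; have p2 := pi_ge2 R.
have p4 : pi <= 4 :> R by have := pihalf_lt2 R; rewrite ltr_pdivrMr //; lra.
rewrite [2 / pi * y]mulrAC ler_pdivlMr // ler_pdivrMr //.
move: (@pi R) p0 p2 p4 => p p0 p2 p4; apply/andP; split; nra.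
Qed.

(** A Cauchy variable exceeds its scale in absolute value with probability exactly 1/2, as atan 1 =
    pi / 4. The slope of atan on [1, 1 + eta] is at least 1/3, and 2 / pi >= 1/2. *)
Lemma atan_above1 : 0 < eta -> eta <= 10^-1 -> 2^-1 + eta / 6 <= 2 / pi * atan (1 + eta).
Proof.
move=> e0 e1; have p0 := pi_gt0 R.
have h : eta / 3 <= atan (1 + eta) - pi / 4.
  rewrite -atan1; apply: le_trans (ger_atanB ler01 _); last by rewrite lerDl ltW.
  by rewrite addrC addKr ler_pM2l // lef_pV2 ?posrE; nra.
have /andP[h2 _] : eta / 3 / 2 <= 2 / pi * (eta / 3) <= eta / 3.
  by apply: two_div_pi; rewrite divr_ge0 ?ltW.
have h3 : 2 / pi * (eta / 3) <= 2 / pi * (atan (1 + eta) - pi / 4).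
  by rewrite ler_pM2l // divr_gt0.
move: h3; rewrite mulrBr; move: h2.
have -> : 2 / pi * (pi / 4) = 2^-1 :> R.
  by move: (@pi R) p0 => p p0; field; rewrite gt_eqF.
lra.
Qed.

Lemma atan_below1 : 0 < eta -> eta <= 10^-1 -> 2 / pi * atan (1 - eta) <= 2^-1 - eta / 4.
Proof.
move=> e0 e1; have p0 := pi_gt0 R.
have h : eta / 2 <= pi / 4 - atan (1 - eta).
  rewrite -atan1; apply: le_trans (ger_atanB _ _); [|lra|lra].
  by rewrite subKr expr1n.
have /andP[h2 _] : eta / 2 / 2 <= 2 / pi * (eta / 2) <= eta / 2.
  by apply: two_div_pi; rewrite divr_ge0 ?ltW.
have h3 : 2 / pi * (eta / 2) <= 2 / pi * (pi / 4 - atan (1 - eta)).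
  by rewrite ler_pM2l // divr_gt0.
move: h3; rewrite mulrBr; move: h2.
have -> : 2 / pi * (pi / 4) = 2^-1 :> R.
  by move: (@pi R) p0 => p p0; field; rewrite gt_eqF.
lra.
Qed.

Lemma atan_small (t : R) : 0 < t -> 2 / pi * atan t <= t.
Proof.
move=> t0; have /andP[_ h] := two_div_pi (ltW (atan_gt0 t0)); apply: le_trans h _.
by have := ler_atanB (ltW t0); rewrite atan0 !subr0.
Qed.

Lemma atan_large (t : R) : 0 < t -> 1 - 2 / pi * atan t <= t^-1.
Proof.
move=> t0; have tv0 : 0 < t^-1 by rewrite invr_gt0.
apply: le_trans (atan_small tv0); rewrite (atanV t0) mulrBr lerD2r.
by rewrite mulrA divfK ?gt_eqF ?pi_gt0 // divff.
Qed.

Lemma unlikely_rare e : 0 < eta -> eta <= 10^-1 -> 0 < mass ->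
  n%:R / (2 ^ k)%:R <= eta / 40 ->
  \sum_f (unlikely e f)%:R <= (2^-1 - eta / 10) * #|{: Row}|%:R :> R.
Proof.
move=> e0 e1 m0 errle; have K0 : 0 <= #|{: Row}|%:R :> R by rewrite ler0n.
have tail j t : 0 < t -> \sum_f (t * c j < `|resid j f|)%R%:R <=
    (1 - 2 / pi * atan t + eta / 40) * #|{: Row}|%:R.
  move=> t0; rewrite -sum_dir; apply: le_trans (dot_tail _ _ t0) _.
  by rewrite ler_wpM2r // lerD2l.
case: e => [[]|p] /=.
- apply: le_trans (tail _ _ _) _; first by lra.
  by rewrite ler_wpM2r //; have := atan_above1 e0 e1; lra.
- apply: le_trans (sum_orb_le _ _) _.
  apply: (@le_trans _ _ ((2 / pi * atan 8^-1 + eta / 40) * #|{: Row}|%:R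
    + (1 - 2 / pi * atan 8 + eta / 40) * #|{: Row}|%:R)).
    apply: lerD; last by apply: tail.
    apply: le_trans (dot_small_ball k m0 _) _; first by rewrite invr_gt0.
    by rewrite ler_wpM2r // lerD2l.
  rewrite -mulrDl ler_wpM2r //.
  have : 2 / pi * atan 8^-1 <= 8^-1 :> R by apply: atan_small; rewrite invr_gt0.
  have : 1 - 2 / pi * atan 8 <= 8^-1 :> R by apply: atan_large.
  lra.
set g := net_point p; apply: le_trans (sum_orb_le _ _) _.
have T0 : 0 < 10 / eta by rewrite divr_gt0.
apply: (@le_trans _ _ ((2 / pi * atan (1 - eta) + eta / 40) * #|{: Row}|%:R
  + (1 - 2 / pi * atan (10 / eta) + eta / 40) * #|{: Row}|%:R)).
  apply: lerD; last first.
    apply: le_trans (dot_tail _ _ T0) _.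
    by rewrite ler_wpM2r // lerD2l.
  (* The small-ball bound needs a positive scale; at cost 0 the strict inequality defining the event
     never holds. *)
  have [g0|g0] := leP (c g) 0.
    rewrite big1 => [|f _]; last first.
      rewrite ltNge (le_trans _ (normr_ge0 _)) //.
      by rewrite mulr_ge0_le0 //; lra.
    rewrite mulr_ge0 // addr_ge0 ?divr_ge0 ?(ltW e0) //.
    rewrite mulr_ge0 ?divr_ge0 ?pi_ge0 // ltW // atan_gt0; lra.
  apply: (@le_trans _ _ (\sum_(f : Row) (`|resid g f| <= (1 - eta) * c g)%R%:R)).
    by apply: ler_sum => f _; rewrite ler_nat; case: ltP => // /ltW ->.
  rewrite -sum_dir; apply: le_trans (dot_small_ball _ _ _) _; rewrite ?sum_dir //; first lra.
  by rewrite ler_wpM2r // lerD2l.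
rewrite -mulrDl ler_wpM2r //.
(* This case fixes the constants: eta / 4 is gained, eta / 10 goes to the slope cut and eta / 20 to
   discretization, leaving exactly eta / 10. *)
have := atan_large T0; rewrite invf_div; have := atan_below1 e0 e1; lra.
Qed.

End decoding.

Lemma truncnS_le (R : realType) (y : R) : 0 <= y -> (Num.truncn y).+1%:R <= y + 1.
Proof. by move=> y0; rewrite -natr1 lerD2r truncn_le. Qed.

(** * Number of rows, failure probability and running time *)

Section parameters.
Variables (R : realType) (eps : R).
Hypotheses (eps0 : 0 < eps) (eps1 : eps < 1).

Let lam : R := Num.max 1 (ln (1 / eps)).

(** The margin is d = eps / 100, so d^2 times the number of rows is at least 21 lam. Of the
    resulting factor exp (-21 lam), two powers of exp lam >= 1 / eps cancel the eps^-2 in the size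
    of the net, and the other 19, each at least 2, beat its constant: 2^19 > 3 * 146004. *)
Definition rate : R := 100 * 100 * 21.
Definition num_rows : nat := (Num.truncn (rate * (lam / eps ^+ 2))).+1.

Let lam_ge1 : 1 <= lam. Proof. by rewrite le_max lexx. Qed.

Let inv_eps_gt1 : 1 < 1 / eps. Proof. by rewrite ltr_pdivlMr // mul1r. Qed.

Let ratio_ge1 : 1 <= lam / eps ^+ 2.
Proof.
rewrite ler_pdivlMr ?exprn_gt0 // mul1r (le_trans _ lam_ge1) //.
by rewrite exprn_ile1 // ltW.
Qed.

Let lam_le : lam <= 1 / eps.
Proof.
rewrite ge_max (ltW inv_eps_gt1) /=.
have u0 : 0 < 1 / eps by rewrite (lt_trans _ inv_eps_gt1).
rewrite -ler_expR lnK ?posrE //; apply: le_trans (expR_ge1Dx _).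
by rewrite lerDr.
Qed.

Lemma num_rows_le : num_rows%:R <= (rate + 1) * (lam / eps ^+ 2).
Proof.
apply: le_trans (truncnS_le _) _; last by rewrite mulrDl mul1r lerD2l.
by rewrite mulr_ge0 ?(le_trans ler01) // /rate; lra.
Qed.

Lemma num_rows_le_cube : num_rows%:R <= (rate + 1) * (1 / eps) ^+ 3.
Proof.
apply: le_trans num_rows_le _; rewrite ler_wpM2l //; first by rewrite /rate; lra.
apply: le_trans (_ : 1 / eps / eps ^+ 2 <= _).
  by rewrite ler_pM2r // invr_gt0 exprn_gt0.
by rewrite !div1r exprVn -invfM -exprS.
Qed.

Lemma failure_le (L : nat) : L%:R <= 730 / (eps / 10) ^+ 2 + 1 ->
  (2 + 2 * L)%:R * (1 - (eps / 10 / 10) ^+ 2) ^+ num_rows <= 3^-1 :> R.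
Proof.
move=> LL; set d := (eps / 10 / 10) ^+ 2.
have e2 : 0 < eps ^+ 2 by rewrite exprn_gt0.
have dE : d = eps ^+ 2 / (100 * 100) by rewrite /d; field.
have dm : 21 * lam <= d * num_rows%:R.
  have : rate * (lam / eps ^+ 2) <= num_rows%:R.
    by rewrite ltW // /num_rows truncnS_gt.
  move/(ler_wpM2l (ltW e2)) => h.
  rewrite dE mulrAC ler_pdivlMr; last lra.
  move: h; have -> : eps ^+ 2 * (rate * (lam / eps ^+ 2)) = rate * lam.
    by field; rewrite gt_eqF.
  rewrite /rate; lra.
set E := expR lam; have E0 : 0 < E by exact: expR_gt0.
have E2 : 2 <= E by apply: le_trans (expR_ge1Dx _); move: lam_ge1; lra.
have Eeps : 1 / eps <= E.
  have u0 : 0 < 1 / eps by rewrite (lt_trans _ inv_eps_gt1).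
  by rewrite -[leLHS]lnK ?posrE // ler_expR /lam le_max lexx orbT.
have pw : (1 - d) ^+ num_rows <= (E ^+ 21)^-1.
  apply: (@le_trans _ _ (expR (- d) ^+ num_rows)).
    rewrite lerXn2r ?nnegrE ?expR_ge0 ?expR_ge1Dx //.
    have : eps ^+ 2 <= 1 by rewrite exprn_ile1 // ltW.
    rewrite dE subr_ge0 ler_pdivrMr; lra.
  rewrite -expRM_natr -expRM_natr -expRN ler_expR.
  by rewrite mulNr lerN2 mulrC.
have : (1 / eps) ^+ 2 * 2 ^+ 19 <= E ^+ 21.
  rewrite (exprD E 2 19) ler_pM ?exprn_ge0 ?lerXn2r ?nnegrE ?(ltW E0) ?divr_ge0 ?(ltW eps0) //.
set u := 1 / eps; have u1 : 1 < u := inv_eps_gt1.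
have LE : 730 / (eps / 10) ^+ 2 = 730 * 100 * u ^+ 2 by rewrite /u; field; rewrite gt_eqF.
rewrite LE in LL => EE.
apply: le_trans (ler_wpM2l (ler0n _ _) pw) _.
rewrite ler_pdivrMr ?exprn_gt0 // mulrC ler_pdivlMr //.
apply: le_trans EE.
have u2 : 1 <= u ^+ 2 by rewrite exprn_ege1 // ltW.
rewrite natrD natrM.
have -> : 2 ^+ 19 = 512 * 1024 :> R by ring.
lra.
Qed.

(** The time is in fact polynomial: 84 is the sum of the coefficients of a quartic in the number of
    rows, which is O(eps^-3). The exponential enters through 1 + y <= exp y. *)
Lemma time_le :
  (num_rows * (num_rows * (2 * (num_rows * (num_rows * 10 + 19)) + 18) + 4) + 4)%N%:R
  <= expR ((84 * (rate + 1) ^+ 4) * (1 / eps) ^+ 12).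
Proof.
set N := num_rows; have N1 : (0 < N)%N by [].
apply: (@le_trans _ _ (84 * N ^ 4)%N%:R).
  rewrite ler_nat; have : (1 <= N)%N by [].
  move: N N1 => N _ N1; rewrite !expnS expn0 muln1.
  have : (N <= N * N)%N by rewrite leq_pmulr.
  have : (N * N <= N * (N * N))%N by rewrite leq_pmull.
  have : (N * (N * N) <= N * (N * (N * N)))%N by rewrite leq_pmull.
  nia.
apply: (@le_trans _ _ (84 * (rate + 1) ^+ 4 * (1 / eps) ^+ 12)); last first.
  by apply: le_trans (expR_ge1Dx _); rewrite lerDr.
rewrite natrM natrX -mulrA ler_wpM2l //.
have -> : (1 / eps) ^+ 12 = ((1 / eps) ^+ 3) ^+ 4 by rewrite -exprM.
rewrite -exprMn lerXn2r ?nnegrE //; last exact: num_rows_le_cube.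
by apply: le_trans num_rows_le_cube.
Qed.

End parameters.

(** * The sketch matrix and its residuals *)

Section sketch.
Variables (R : realType) (n k m : nat).
Local Notation Row := {ffun 'I_n -> 'I_(2 ^ k)}.
Local Notation Om := {ffun 'I_m -> Row}.

Lemma half_ord_subproof (i : 'I_(m.*2)) : (i./2 < m)%N.
Proof. by rewrite ltn_half_double. Qed.

(** Both rows of a pair use the same nodes, so a - j b is the product of a single random row with
    the vector [dir x j]. *)
Definition sketch (w : Om) : 'M[R]_(m.*2, n) :=
  \matrix_(i, j) ((if odd i then 1 else j.+1%:R)
                  * cauchy_node R (w (Ordinal (half_ord_subproof i)) j)).

Lemma rmem_input (l : nat) (eps : R) (y : 'cV[R]_l) (i : 'I_l) :
  rmem (input n eps y) i = y i 0.
Proof. by rewrite /= valK. Qed.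

Lemma residual_sketch (eps : R) (w : Om) (x : 'cV[R]_n) (j : R) (q : 'I_m) :
  residual (rmem (input n eps (sketch w *m x))) j q = resid x j (w q) ^+ 2.
Proof.
have lt0 : (q.*2 < m.*2)%N by rewrite ltn_double.
have lt1 : (q.*2.+1 < m.*2)%N by rewrite ltn_Sdouble.
rewrite /residual (rmem_input eps _ (Ordinal lt0)) (rmem_input eps _ (Ordinal lt1)).
rewrite -expr2; congr (_ ^+ 2).
have h0 : Ordinal (half_ord_subproof (Ordinal lt0)) = q.
  by apply: val_inj; rewrite /= doubleK.
have h1 : Ordinal (half_ord_subproof (Ordinal lt1)) = q.
  by apply: val_inj; rewrite /= uphalf_double.
rewrite !mxE mulr_sumr -sumrB /resid /dot; apply: eq_bigr => i _.
by rewrite !mxE h0 h1 /= odd_double /dir /=; ring.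
Qed.

Lemma feasible_sketch (eps : R) (w : Om) (x : 'cV[R]_n) (j v : R) :
  feasible m (rmem (input n eps (sketch w *m x))) j v =
  (m <= 2 * #|[pred i | (resid x j (w i) ^+ 2 <= v)%R]|)%N.
Proof.
rewrite /feasible below_card; congr (_ <= 2 * _)%N; apply: eq_card => q.
by rewrite !inE residual_sketch.
Qed.

End sketch.

Section enumerated_space.
Variables (R : realType) (T : finType) (t0 : T).

Lemma uniform_nat_enum (p : pred T) :
  uniform_nat R #|T|.-1 [set i | p (nth t0 (enum T) i)] =
  (#|T|%:R^-1 * \sum_t (p t)%:R)%:E.
Proof.
have T0 : (0 < #|T|)%N by apply/card_gt0P; exists t0.
rewrite uniform_natE prednK //; congr (_ * _)%:E.
rewrite -(big_mkord xpredT (fun i => (i \in [set i | p (nth t0 (enum T) i)])%:R)).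
rewrite -[RHS]big_enum /= (big_nth t0) -cardE; apply: eq_bigr => i _.
by congr (nat_of_bool _)%:R; apply/idP/idP => [/set_mem //|h]; exact: mem_set.
Qed.

Lemma prob_uniform_nat (p : pred T) (E : set nat) :
  (forall i, p (nth t0 (enum T) i) -> E i) ->
  2 / 3 * #|T|%:R <= \sum_t (p t)%:R :> R ->
  prob_at_least (uniform_nat R #|T|.-1) (2 / 3) E.
Proof.
move=> pE h; exists [set i | p (nth t0 (enum T) i)]; split=> //.
have T0 : (0 < #|T|)%N by apply/card_gt0P; exists t0.
by rewrite [X in (_ <= X)%E](uniform_nat_enum p) lee_fin [leRHS]mulrC ler_pdivlMr // ltr0n.
Qed.

End enumerated_space.

Theorem mainTheorem17 (R : realType) :
  exists (prog : program) (C : R) (q : {poly R}),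
  forall (eps : R) (n : nat), 0 < eps < 1 ->
  exists (m : nat) (d : measure_display) (T : measurableType d)
         (P : probability T R) (M : T -> 'M[R]_(m, n)) (dec : 'cV[R]_m -> R),
    [/\ m%:R <= C * (Num.max 1 (ln (1 / eps)) / eps ^+ 2),
        forall (i : 'I_m) (k : 'I_n), measurable_fun setT (fun w => M w i k),
        forall y : 'cV[R]_m,
          outputs_in_time prog (input n eps y) (expR q.[1 / eps]) (dec y)
      & forall x : 'cV[R]_n,
          prob_at_least P (2 / 3)
            [set w | cost x (dec (M w *m x)) <= (1 + eps) * median_cost x]].
Proof.
have two_thirds (S K : R) : S <= 3^-1 * K -> 2 / 3 * K <= K - S by lra.
(* The factor 2 accounts for the two measurements of each row pair. *)
exists median_program, (2 * (rate R + 1)), ((84 * (rate R + 1) ^+ 4) *: 'X^12).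
move=> eps n /andP[eps0 eps1].
set m := num_rows eps.
(* The decoder loses a factor 1 + 10 eta, whence eta = eps / 10. As 2^k > k, this k keeps the
   discretization error below eta / 40. *)
pose k := (Num.truncn (40 * n%:R / (eps / 10))).+1.
have eta0 : 0 < eps / 10 by rewrite divr_gt0.
have err : n%:R / (2 ^ k)%:R <= eps / 10 / 40 :> R.
  have : 40 * n%:R / (eps / 10) <= (2 ^ k)%:R.
    apply: (@le_trans _ _ k%:R); last by rewrite ler_nat ltnW // ltn_expl.
    by apply: ltW; exact: truncnS_gt.
  by rewrite ler_pdivrMr // ler_pdivrMr ?ltr0n ?expn_gt0 //; lra.
pose Row := {ffun 'I_n -> 'I_(2 ^ k)}.
pose Om := {ffun 'I_m -> Row}.
have zero_lt : (0 < 2 ^ k)%N by rewrite expn_gt0.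
pose w0 : Om := [ffun=> [ffun=> Ordinal zero_lt]].
pose om (i : nat) : Om := nth w0 (enum Om) i.
(* The program is correct on every vector y, sketch or not, so the decoder is a function of y
   alone. *)
have decode (y : 'cV[R]_(m.*2)) : exists r : R,
    outputs_in_time median_program (input n eps y)
      (expR ((84 * (rate R + 1) ^+ 4) *: 'X^12).[1 / eps]) r /\
    forall j v, feasible m (rmem (input n eps y)) j v ->
      feasible m (rmem (input n eps y)) r v.
  have [u [s [es us sv]]] := @median_program_spec R m (rmem (input n eps y)) isT
    (input n eps y) erefl erefl erefl erefl erefl.
  exists (rreg s 0); split=> //; exists u, s; split=> //.
  move: us; rewrite -(ler_nat R) => /le_trans; apply.
  by rewrite hornerZ hornerXn; exact: time_le.
have [dec decP] := choice decode.
exists m.*2, _, nat, (uniform_nat R #|Om|.-1), (fun i => sketch R (om i)), dec.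
split.
- rewrite -muln2 natrM mulrC -mulrA ler_wpM2l //; exact: num_rows_le.
- by move=> i j _ Y _.
- by move=> y; have [] := decP y.
move=> x; have [js [jsE _]] := median_cost_attained x; rewrite -jsE.
(* For x = 0 the net is degenerate, but every output has cost 0. *)
have [mass0|mass0] := leP (mass x) 0.
  have c0 j : cost x j = 0.
    rewrite /cost big1 // => i _.
    have /eqP : mass x = 0 by apply/eqP; rewrite eq_le mass0 sumr_ge0.
    rewrite psumr_eq0 // => /allP/(_ i).
    by rewrite mem_index_enum => /(_ isT)/eqP ->; rewrite mul0r.
  apply: (@prob_uniform_nat _ _ w0 xpredT); first by move=> i _ /=; rewrite !c0 mulr0.
  rewrite sumr_const -[leRHS]mulr_natl mulr1 ler_piMl //; lra.
pose L := (Num.truncn (730 / (eps / 10) ^+ 2)).+1.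
have eta1 : eps / 10 <= 10^-1 by rewrite ler_pdivrMr // mulVf // ltW.
pose bad : pred Om := some_majority (@unlikely R n k x (eps / 10) js L) (m := m).
apply: (@prob_uniform_nat _ _ w0 (predC bad)).
  move=> i good /=; have [_ opt] := decP (sketch R (om i) *m x).
  have -> : eps = 10 * (eps / 10) by field.
  apply: (decode_near_optimal eta0 eta1 mass0 _ good) => [|j v]; first exact: truncnS_gt.
  by rewrite -!(feasible_sketch eps); exact: opt.
have Row0 : (0 < #|Row|)%N by apply/card_gt0P; exists [ffun=> Ordinal zero_lt].
have d0 : 0 <= eps / 10 / 10 by rewrite divr_ge0 // ltW.
have rareE (e : bool + bool * 'I_L) : \sum_(f : Row) (unlikely x (eps / 10) js e f)%:R <=
    (2^-1 - eps / 10 / 10) * #|{: Row}|%:R :> R.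
  exact: unlikely_rare.
have rare := some_majority_rare m Row0 d0 rareE.
have L_le : L%:R <= 730 / (eps / 10) ^+ 2 + 1.
  have h730 : 0 <= 730 / (eps / 10) ^+ 2 :> R.
    apply: divr_ge0; first exact: ler0n.
    exact: sqr_ge0.
  exact: (truncnS_le h730).
have fail := failure_le eps0 eps1 L_le.
have -> : \sum_t (predC bad t)%:R = #|Om|%:R - \sum_t (bad t)%:R :> R.
  rewrite -sum1_card natr_sum -sumrB; apply: eq_bigr => t _ /=.
  by case: (bad t); rewrite ?subrr ?subr0.
have cardJ : #|{: bool + bool * 'I_L}| = (2 + 2 * L)%N.
  by rewrite card_sum card_prod card_bool card_ord.
rewrite cardJ in rare.
have : \sum_t (bad t)%:R <= 3^-1 * #|Om|%:R :> R.
  by apply: le_trans rare _; rewrite ler_wpM2r.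
exact: two_thirds.
Qed.
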